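(* Let $\varphi_0$ be a probability density on $\mathbb R$, absolutely continuous and strictly positive, with $\int x\varphi_0\,dx=0$, $\int x^2\varphi_0\,dx=1$ and finite Fisher information $J_0:=\int(\varphi_0')^2/\varphi_0\,dx<\infty$ ($\varphi_0'$ the a.e. derivative). Let $\mathcal L_{\varphi_0}=\{p_{\mu,\sigma}=\sigma^{-1}\varphi_0((\cdot-\mu)/\sigma):\mu\in\mathbb R,\sigma>0\}$ be the location-scale family it generates. For $U=2J$ and $e=0$: (i) $(\mathcal L_{\varphi_0},\mathcal W_2)$ is isometric to the Euclidean half-plane $\{(\mu,\sigma):\sigma>0\}$ with metric $d\mu^2+d\sigma^2$, and $J(p_{\mu,\sigma})=J_0/\sigma^2$, whence $U=2J_0/\sigma^2$ on $\mathcal L_{\varphi_0}$; (ii) the intrinsic Gauss curvature of $(\mathcal L_{\varphi_0},\tilde g_{0,2J})$ is constant, equal to $$K_{\varphi_0}=-\frac{1}{4J_0}<0;$$ (iii) $J_0\ge 1$, with equality if and only if $\varphi_0$ is Gaussian; hence $K_{\varphi_0}\in[-\tfrac14,0)$, and the extremal value $-\tfrac14$ is attained by the Gaussian leaf.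
   Context: $\mathcal W_2$ is the quadratic Wasserstein distance on probability measures on $\mathbb R$ with finite second moment and $g_{\mathcal W_2}$ the corresponding transport metric. $J(p)=\int (p')^2/p\,dx$ is the Fisher information. The cost metric at level $e=0$ with relief $U$ is $\tilde g_{0,U}=2U\,g_{\mathcal W_2}$; on $\mathcal L_{\varphi_0}$ in coordinates $(\mu,\sigma)$, $\tilde g_{0,2J}=4J\,(d\mu^2+d\sigma^2)$. Standard imported fact: in one dimension the quantile map $p\mapsto F_p^{-1}$ is an isometry of $(\mathcal P_2(\mathbb R),\mathcal W_2)$ onto the cone of nondecreasing functions in $L^2(0,1)$. *)

(* Defs.v *)
From HB Require Import structures.
From mathcomp Require Import all_boot all_order all_algebra.
From mathcomp Require Import all_classical all_reals all_analysis.
Import Order.TTheory GRing.Theory Num.Theory.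
Import numFieldNormedType.Exports.

Set Implicit Arguments.
Unset Strict Implicit.
Unset Printing Implicit Defensive.

Local Open Scope classical_set_scope.
Local Open Scope ring_scope.

Section Densities.
Variable R : realType.
Local Notation mu := (@lebesgue_measure R).
Implicit Types (p f v : R -> R).

(* epsilon-delta absolute continuity on the compact interval [a, b]; the finite
   family of pairwise non-overlapping subintervals is (]u i, v i[)_(i < n) *)
Definition abs_cont_itv (a b : R) f : Prop :=
  forall eps : R, 0 < eps -> exists2 delta : R, 0 < delta &
    forall (n : nat) (u v : 'I_n -> R),
      (forall i, [/\ a <= u i, u i <= v i & v i <= b]) ->
      (forall i j, i != j -> v i <= u j \/ v j <= u i) ->
      \sum_(i < n) (v i - u i) < delta ->
      \sum_(i < n) `|f (v i) - f (u i)| < eps.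

Definition abs_cont f : Prop := forall a b : R, a <= b -> abs_cont_itv a b f.

(* [derive1 p] is the everywhere-defined limit operator of the library: for an
   absolutely continuous p it is the genuine derivative almost everywhere, and
   its value on the exceptional null set does not affect the integral. *)
Definition fisher p : \bar R := (\int[mu]_x (derive1 p x ^+ 2 / p x)%:E)%E.

Record standard_profile (phi0 : R -> R) : Prop := StandardProfile {
  sp_abs_cont : abs_cont phi0 ;
  sp_gt0 : forall x, 0 < phi0 x ;
  sp_mass : (\int[mu]_x (phi0 x)%:E = 1)%E ;
  sp_mean : (\int[mu]_x (x * phi0 x)%:E = 0)%E ;
  sp_var : (\int[mu]_x (x ^+ 2 * phi0 x)%:E = 1)%E ;
  sp_fisher : (fisher phi0 < +oo)%E }.

Definition is_gaussian p : Prop :=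
  exists m s : R, 0 < s /\ p = normal_pdf m s.

Definition law p : set (measurableTypeR R) -> \bar R :=
  fun A => (\int[mu]_(x in A) (p x)%:E)%E.

Definition coupling (P Q : set (measurableTypeR R) -> \bar R) :
    set (probability (measurableTypeR R * measurableTypeR R)%type R) :=
  [set g | forall A, measurable A ->
             g (A `*` setT) = P A /\ g (setT `*` A) = Q A].

Definition W2 (P Q : set (measurableTypeR R) -> \bar R) : \bar R :=
  sqrte (ereal_inf
    [set (\int[g]_z ((z.1 - z.2) ^+ 2)%:E)%E | g in coupling P Q]).

Definition test_function f : Prop :=
  [/\ forall x, derivable f x 1, continuous (derive1 f) &
      exists M : R, forall x, M < `|x| -> f x = 0].

(* Finite-energy velocity fields v driving the curve of densities q at time 0:
   weak form of the continuity equation  d/dt q + (q v)' = 0. *)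
Definition velocity_field (q : R -> R -> R) : set (R -> R) :=
  [set v : R -> R | [/\ measurable_fun [set: R] v,
      (\int[mu]_x ((v x) ^+ 2 * q 0 x)%:E < +oo)%E &
      forall f, test_function f ->
        is_derive (0 : R) (1 : R) (fun t : R => \int[mu]_x (f x * q t x))
                  (\int[mu]_x (derive1 f x * v x * q 0 x))]].

(* Squared norm of the tangent vector of the curve q at time 0 for the
   quadratic transport (Otto, Benamou-Brenier) metric: least kinetic energy. *)
Definition transport_sqnorm (q : R -> R -> R) : \bar R :=
  ereal_inf
    [set (\int[mu]_x ((v x) ^+ 2 * q 0 x)%:E)%E | v in velocity_field q].

End Densities.

Section Surfaces.
Variable R : realType.
Implicit Types (x y xi : 'rV[R]_2) (i j k l : 'I_2).

Definition basis_vec i : 'rV[R]_2 := delta_mx 0 i.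

(* Gram matrix, in the coordinates of the parametrisation p, of the transport
   metric; off-diagonal entries come from the squared norm by polarization. *)
Definition transport_metric (p : 'rV[R]_2 -> R -> R) x : 'M[R]_2 :=
  let N xi := fine (transport_sqnorm (fun t : R => p (x + t *: xi))) in
  \matrix_(i, j) ((N (basis_vec i + basis_vec j)
                   - N (basis_vec i - basis_vec j)) / 4).

(* the cost metric 2 U g_{W2} at level e = 0 *)
Definition cost_metric0 (U : (R -> R) -> \bar R) (p : 'rV[R]_2 -> R -> R) x :
    'M[R]_2 :=
  (2 * fine (U (p x))) *: transport_metric p x.

Definition christoffel (g : 'rV[R]_2 -> 'M[R]_2) k i j x : R :=
  2^-1 * \sum_l invmx (g x) k l *
    ('D_(basis_vec i) (fun y => g y j l) x
     + 'D_(basis_vec j) (fun y => g y i l) x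
     - 'D_(basis_vec l) (fun y => g y i j) x).

(* component along d_l of R(d_i, d_j) d_k, where
   R(X, Y) = [nabla_X, nabla_Y] - nabla_[X, Y] *)
Definition riemann (g : 'rV[R]_2 -> 'M[R]_2) l i j k x : R :=
  'D_(basis_vec i) (christoffel g l j k) x
  - 'D_(basis_vec j) (christoffel g l i k) x
  + \sum_m (christoffel g l i m x * christoffel g m j k x
            - christoffel g l j m x * christoffel g m i k x).

(* <R(d_0, d_1) d_1, d_0> / det g *)
Definition gauss_curvature (g : 'rV[R]_2 -> 'M[R]_2) x : R :=
  (\sum_l g x 0 l * riemann g l 0 1 1 x) / \det (g x).

(* coordinates: mu = x 0 0 and sigma = x 0 1 *)
Definition half_plane : set 'rV[R]_2 := [set x | 0 < x 0 1].

(* the norm of 'rV[R]_2 in the library is the sup norm *)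
Definition euclid_dist x y : R :=
  Num.sqrt ((x 0 0 - y 0 0) ^+ 2 + (x 0 1 - y 0 1) ^+ 2).

Definition locscale (phi0 : R -> R) x : R -> R :=
  fun z => (x 0 1)^-1 * phi0 ((z - x 0 0) / x 0 1).

Definition locscale_family (phi0 : R -> R) : set (R -> R) :=
  locscale phi0 @` half_plane.

Definition relief_2J (p : R -> R) : \bar R := (2%:E * fisher p)%E.

End Surfaces.

(* Main.v *)
Require Import Defs.
From HB Require Import structures.
From mathcomp Require Import all_boot all_order all_algebra.
From mathcomp Require Import all_classical all_reals all_analysis.
From mathcomp Require Import measurable_realfun.
From mathcomp Require Import ring lra.
Import Order.TTheory GRing.Theory Num.Theory.
Import numFieldNormedType.Exports.
Set Implicit Arguments.
Unset Strict Implicit.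
Unset Printing Implicit Defensive.
Local Open Scope classical_set_scope.
Local Open Scope ring_scope.

(** The affine maps y |-> m + s y carry phi0 to every member of its
    location-scale family.  Pushing phi0 forward by a pair of them couples two
    members at cost d(m)^2 + d(s)^2; conversely AM-GM bounds the transport cost
    below, pointwise, by a sum of a function of each variable, whose integral
    depends only on the marginals.  The tangent vector xi is driven by the
    affine velocity field v0, and any other admissible field v satisfies
    int f' v p = int f' v0 p for test functions f; since v^2 >= 2 v f' - f'^2 and
    f' can approximate v0 in L^2(p), v0 has least energy, so that the transport
    metric is the identity matrix and the cost metric is (4 J0 / s^2) I.

    For J0 >= 1, integration by parts against x gives
    int (phi0'/phi0 + x)^2 phi0 = J0 - 1.  If J0 = 1 then phi0' = - x phi0 almost
    everywhere, and the absolutely continuous function phi0 exp(x^2/2) is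
    constant.  Both steps need the fundamental theorem of calculus for absolutely
    continuous functions: the total variation of such a function is absolutely
    continuous, hence so is its Stieltjes measure, and the Radon-Nikodym density
    of the latter is the derivative by Lebesgue's differentiation theorem. *)

(** * The fundamental theorem of calculus for absolutely continuous functions *)

Section variation.
Context {R : realType}.
Implicit Types (a b : R) (f g : R -> R) (s t : seq (R * R)) (p q : R * R).
Notation mu := (@lebesgue_measure R).

(** The distance and the metric tensor have independent definitions, by couplings and by velocity
    fields, and are computed independently. Both turn out Euclidean because the profile is
    standardised, so that the second moment of [a + b y] is [a^2 + b^2]. Two obstacles shape the
    rest. The profile is differentiable only almost everywhere, so a derivative along a curve of
    parameters is not taken on the density: the integral is pulled back to the fixed profile, where
    the parameter occurs only inside a smooth test function. And the natural objects (the weight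
    [x], the field [v0], its quadratic primitive) lack compact support: they are multiplied by a C^1
    cutoff at scale [n + 1], whose derivative is of order [1/n] on its support, so that multiplying
    by it lowers growth by one degree and dominated convergence applies. In the curvature of
    [c / s^2] times the identity, the Christoffel symbols do not depend on [c]; it enters only when
    an index is lowered and the determinant divided out. *)

Definition sub_itv a b p := [&& a <= p.1, p.1 <= p.2 & p.2 <= b].

Definition nonoverlap p q := (p.2 <= q.1) || (q.2 <= p.1).

Lemma nonoverlapC : symmetric nonoverlap.
Proof. by move=> p q; rewrite /nonoverlap orbC. Qed.

(** Lists replace families indexed by ['I_n] because refining an interval then amounts to
    concatenating the list of its pieces, which suits induction. *)
Definition seq_abs_cont a b f := forall e : R, 0 < e ->
  exists2 d : R, 0 < d & forall s, all (sub_itv a b) s -> pairwise nonoverlap s ->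
    \sum_(p <- s) (p.2 - p.1) < d -> \sum_(p <- s) `|f p.2 - f p.1| < e.

Lemma abs_cont_seq a b f : abs_cont_itv a b f -> seq_abs_cont a b f.
Proof.
move=> acf e e0; have [d d0 acd] := acf e e0; exists d => // s sab sno.
rewrite 2!(big_tnth _ _ s); apply: acd => [i|i j ij].
  by have /allP/(_ _ (mem_tnth i (in_tuple s)))/and3P[] := sab.
have no x y : (x < y < size s)%N -> nonoverlap (nth (0, 0) s x) (nth (0, 0) s y).
  move=> /andP[xy ys]; move/(pairwiseP (0, 0)) : sno; apply => //.
  by rewrite inE (ltn_trans xy).
have : nonoverlap (nth (0, 0) s i) (nth (0, 0) s j).
  have [ij'|ij'|] := ltngtP i j; last by move/val_inj/eqP; rewrite (negbTE ij).
    by apply: no; rewrite ij' /=.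
  by rewrite nonoverlapC; apply: no; rewrite ij' /=.
by rewrite !(tnth_nth (0, 0)) /= => /orP.
Qed.

Fixpoint steps a (l : seq R) : seq (R * R) :=
  if l is x :: l' then (a, x) :: steps x l' else [::].

Lemma steps_sub a l : path <%R a l -> all (sub_itv a (last a l)) (steps a l).
Proof.
elim: l a => //= x l ih a /andP[ax xl].
rewrite {1}/sub_itv lexx (ltW ax) /=; apply/andP; split.
  by apply: (@itv_partition_le _ _ _ _ l); split.
apply: sub_all (ih _ xl) => p /and3P[xp p12 pl].
by rewrite /sub_itv (le_trans (ltW ax)) // p12.
Qed.

Lemma steps_nonoverlap a l : path <%R a l -> pairwise nonoverlap (steps a l).
Proof.
elim: l a => //= x l ih a /andP[ax xl]; rewrite ih // andbT.
apply: sub_all (steps_sub xl) => p /and3P[xp _ _].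
by rewrite /nonoverlap /= xp.
Qed.

Lemma steps_sum a l : \sum_(p <- steps a l) (p.2 - p.1) = last a l - a.
Proof.
elim: l a => [|x l ih] a /=; first by rewrite big_nil subrr.
by rewrite big_cons ih /= addrC addrA subrK.
Qed.

Lemma steps_variation a b f l : itv_partition a b l ->
  variation a b f l = \sum_(p <- steps a l) `|f p.2 - f p.1|.
Proof.
move=> abl; rewrite variation_zip //.
case: abl => _ _; elim: l a => [|x l ih] a /=; first by rewrite !big_nil.
by rewrite !big_cons ih.
Qed.

Lemma nonoverlap_sub p q r : sub_itv p.1 p.2 r -> nonoverlap p q -> nonoverlap r q.
Proof.
move=> /and3P[p1 p2 p3] /orP[pq|qp]; apply/orP; first by left; exact: le_trans pq.
by right; exact: le_trans p1.
Qed.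

(** The [d] that serves for [f] serves for its variation: subdividing intervals keeps them
    nonoverlapping and preserves their total length. Passing to suprema over partitions weakens [<]
    to [<=]. *)
Lemma abs_cont_tv a b f : abs_cont_itv a b f -> forall e : R, 0 < e ->
  exists2 d : R, 0 < d & forall s, all (sub_itv a b) s -> pairwise nonoverlap s ->
    \sum_(p <- s) (p.2 - p.1) < d ->
    (\sum_(p <- s) total_variation p.1 p.2 f <= e%:E)%E.
Proof.
move=> /abs_cont_seq acf e e0; have [d d0 acd] := acf e e0; exists d => // s.
(* The intervals of [s] are refined one at a time; [t] collects the pieces. *)
suff gen t : all (sub_itv a b) (s ++ t) -> pairwise nonoverlap (s ++ t) ->
    \sum_(p <- s ++ t) (p.2 - p.1) < d ->
    ((\sum_(p <- t) `|f p.2 - f p.1|)%:E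
      + \sum_(p <- s) total_variation p.1 p.2 f <= e%:E)%E.
  by have := gen [::]; rewrite cats0 big_nil add0e.
elim: s t => [|p s ih] t.
  by rewrite big_nil adde0 lee_fin => ? ? ?; apply/ltW/acd.
rewrite cat_cons => /= /andP[pab stab] /andP[pst st_no].
rewrite big_cons => std.
rewrite big_cons addeCA.
have [p1 p12 p2] : [/\ a <= p.1, p.1 <= p.2 & p.2 <= b] by apply/and3P.
have step l : itv_partition p.1 p.2 l ->
    ((variation p.1 p.2 f l)%:E + ((\sum_(p <- t) `|f p.2 - f p.1|)%:E
      + \sum_(p <- s) total_variation p.1 p.2 f) <= e%:E)%E.
  move=> pl; have [pl1 /eqP pl2] := pl.
  rewrite addeA -EFinD (steps_variation f pl) [X in X%:E]addrC -big_cat; apply: ih.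
  - rewrite catA all_cat stab.
    apply: sub_all (steps_sub pl1) => q; rewrite pl2 => /and3P[h1 h2 h3].
    by rewrite /sub_itv h2 (le_trans p1) //= (le_trans h3).
  - rewrite catA pairwise_cat st_no steps_nonoverlap // !andbT.
    apply/allrelP => q r qst rl; rewrite nonoverlapC.
    apply: nonoverlap_sub (allP pst _ qst).
    by have /allP/(_ _ rl) := steps_sub pl1; rewrite pl2.
  - by rewrite catA big_cat /= (steps_sum p.1 l) pl2 addrC.
(* Finiteness is needed to move this sum across the inequality before taking the supremum over
   partitions of the first interval. It follows from [step] at a trivial partition, which is empty
   when the interval is degenerate since partition points increase strictly. *)
have rest_fin : ((\sum_(p <- t) `|f p.2 - f p.1|)%:E
      + \sum_(p <- s) total_variation p.1 p.2 f)%E \is a fin_num.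
  have r0 : (0 <= (\sum_(p <- t) `|f p.2 - f p.1|)%:E
      + \sum_(p <- s) total_variation p.1 p.2 f)%E.
    apply: adde_ge0; first by rewrite lee_fin sumr_ge0.
    rewrite big_seq; apply: sume_ge0 => q qs; apply: total_variation_ge0.
    have : q \in s ++ t by rewrite mem_cat qs.
    by move=> /(allP stab)/and3P[].
  rewrite ge0_fin_numE //; apply: (@le_lt_trans _ _ e%:E); last exact: ltry.
  have [p21|p1p2] := eqVneq p.1 p.2.
    have : itv_partition p.1 p.2 [::] by split; rewrite //= p21.
    by move=> /step; rewrite variation_nil add0e.
  have : itv_partition p.1 p.2 [:: p.2].
    by apply: itv_partition1; rewrite lt_neqAle p1p2.
  move=> /step; apply: le_trans; rewrite leeDr // lee_fin.
  exact: variation_ge0.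
rewrite -leeBrDr //; apply: ge_ereal_sup => _ /= [_ [l pl <-] <-].
by rewrite leeBrDr // step.
Qed.

Lemma seq_abs_contB a b f g : seq_abs_cont a b f -> seq_abs_cont a b g ->
  seq_abs_cont a b (f \- g).
Proof.
move=> acf acg e e0; have e20 : 0 < e / 2 by rewrite divr_gt0.
have [d d0 df] := acf _ e20; have [d' d'0 dg] := acg _ e20.
exists (Num.min d d'); first by rewrite lt_min d0.
move=> s sab sno; rewrite lt_min => /andP[sd sd'].
rewrite [ltRHS]splitr; apply: le_lt_trans (ltrD (df _ sab sno sd) (dg _ sab sno sd')).
rewrite -big_split /=; apply: ler_sum => p _.
rewrite /= (_ : f p.2 - g p.2 - _ = (f p.2 - f p.1) - (g p.2 - g p.1)); last by ring.
exact: ler_normB.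
Qed.

(** Cut the interval into equal pieces shorter than the [d] attached to [1]: each has variation at
    most 1, and variation is additive. *)
Lemma abs_cont_tv_fin a b f : a <= b -> abs_cont_itv a b f ->
  (total_variation a b f < +oo)%E.
Proof.
move=> ab /abs_cont_tv/(_ 1 ltr01)[d d0 acd].
have [n nd] : exists n : nat, (b - a) / n.+1%:R < d.
  exists (Num.truncn ((b - a) / d)).
  rewrite ltr_pdivrMr // mulrC -ltr_pdivrMr //.
  exact: truncnS_gt.
pose h := (b - a) / n.+1%:R.
have h0 : 0 <= h by rewrite divr_ge0 // subr_ge0.
have xb k : (k <= n.+1)%N -> a + h *+ k <= b.
  move=> kn; rewrite -lerBrDl -mulr_natr /h mulrAC ler_pdivrMr //.
  by rewrite ler_wpM2l ?subr_ge0 // ler_nat.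
suff : forall k, (k <= n.+1)%N -> (total_variation a (a + h *+ k) f < +oo)%E.
  move=> /(_ n.+1 (leqnn _)); congr (total_variation _ _ _ < _)%E.
  by rewrite -mulr_natr /h divfK // addrC subrK.
elim=> [_|k ih kn]; first by rewrite mulr0n addr0 total_variationxx ltry.
have ak : a <= a + h *+ k by rewrite lerDl mulrn_wge0.
have kk : a + h *+ k <= a + h *+ k.+1 by rewrite lerD2l mulrSr lerDl.
rewrite (@total_variationD _ _ _ (a + h *+ k)) //.
rewrite lte_add_pinfty ?ih 1?ltnW //.
have := acd [:: (a + h *+ k, a + h *+ k.+1)].
rewrite !big_seq1 /= andbT /sub_itv ak kk (xb _ kn) /= => /(_ isT isT).
rewrite mulrSr addrA [X in X - _]addrC addrK => /(_ nd).
by rewrite -addrA -mulrSr => /le_lt_trans; apply; exact: ltry.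
Qed.

Lemma fine_tvB a b f x y : (total_variation a b f < +oo)%E ->
  a <= x -> x <= y -> y <= b ->
  (fine (total_variation a y f) - fine (total_variation a x f))%:E
   = total_variation x y f.
Proof.
move=> fab ax xy yb; have ay := le_trans ax xy.
have abE := total_variationD f ay yb; have ayE := total_variationD f ax xy.
have fay : total_variation a y f \is a fin_num.
  rewrite ge0_fin_numE ?total_variation_ge0 //; apply: le_lt_trans fab.
  by rewrite abE leeDl // total_variation_ge0.
have fax : total_variation a x f \is a fin_num.
  rewrite ge0_fin_numE ?total_variation_ge0 //.
  move: fay; rewrite ge0_fin_numE ?total_variation_ge0 //.
  by apply: le_lt_trans; rewrite ayE leeDl // total_variation_ge0.
by rewrite EFinB !fineK // ayE addeAC subee // add0e.
Qed.

Lemma seq_abs_cont_tv a b f : a <= b -> abs_cont_itv a b f ->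
  seq_abs_cont a b (fun x => fine (total_variation a x f)).
Proof.
move=> ab acf e e0; have e20 : 0 < e / 2 by rewrite divr_gt0.
have [d d0 dP] := abs_cont_tv acf e20; exists d => // s sab sno sd.
rewrite -lte_fin -sumEFin.
apply: (@le_lt_trans _ _ (e / 2)%:E); last first.
  by rewrite lte_fin ltr_pdivrMr // mulr_natr mulr2n ltrDl.
apply: le_trans (dP _ sab sno sd); rewrite 2!big_seq.
apply: lee_sum => p /(allP sab)/and3P[p1 p2 p3].
rewrite -(fine_tvB (abs_cont_tv_fin ab acf) p1 p2 p3) lee_fin ger0_norm //.
by rewrite -lee_fin (fine_tvB (abs_cont_tv_fin ab acf)) // total_variation_ge0.
Qed.

(** Finite measure excludes the unbounded intervals. An endpoint inside [I] would bring a small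
    closed interval around it into [I], reaching beyond that endpoint. *)
Lemma open_interval_ooE (I : set R) : open I -> is_interval I -> I !=set0 ->
  (mu I < +oo)%E -> exists x y, x < y /\ I = `]x, y[%classic.
Proof.
move=> oI /is_intervalP IE [z Iz]; rewrite IE lebesgue_measure_itv => muI.
have oI' := open_itvcc_subset oI.
move: (Rhull I) IE muI => [l r] IE muI.
have lr : (l < r)%O.
  by rewrite ltNge; apply/negP => rl; move: Iz; rewrite IE set_itv_ge // -leNgt.
move: muI => /=; case: l r lr IE => [bl x|[]] [br y|[]] //= lr IE;
  rewrite ?ltry ?ltNyr ?ltxx //= => muI; last first.
exists x, y.
have xI : ~ I x.
  move=> Ix; near (0:R)^'+ => r.
  have : I (x - r).
    have : `[x - r, x + r] `<=` I by near: r; exact: oI'.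
    by apply; rewrite /= in_itv/= lexx lerD2l ge0_cp.
  rewrite IE /= in_itv => /andP[/lteifW + _].
  by rewrite lerBrDl gerDr leNgt => /negP; apply.
have yI : ~ I y.
  move=> Iy; near (0:R)^'+ => r.
  have : I (y + r).
    have : `[y - r, y + r] `<=` I by near: r; exact: oI'.
    by apply; rewrite /= in_itv/= lexx andbT lerD2l ge0_cp.
  rewrite IE /= in_itv => /andP[_ /lteifW].
  by rewrite gerDl leNgt => /negP; apply.
have Ixy (t : R) : I t -> x < t < y.
  move=> It; have : x <= t <= y.
    by move: It; rewrite IE /= in_itv => /andP[/lteifW -> /lteifW].
  rewrite !le_eqVlt => /andP[/predU1P[xt|->] /predU1P[ty|->]] //.
  - by case: xI; rewrite xt.
  - by case: xI; rewrite xt.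
  - by case: yI; rewrite -ty.
have /andP[xz zy] := Ixy _ Iz; split; first exact: lt_trans zy.
rewrite -IE; apply/seteqP; split => [u /Ixy|u]; rewrite /= in_itv //=.
by move=> /andP[xt ty]; rewrite IE /= in_itv /= !lteifS.
Unshelve. all: by end_near.
Qed.

(** A Stieltjes measure requires a function that is monotone on the whole line, whereas [F] is
    controlled only on [[a, b]]. Precomposing with this 1-Lipschitz monotone retraction extends [F]
    by constants, so the measure is finite as well. *)
Definition clamp a b (x : R) := Num.max a (Num.min x b).

Lemma clamp_ge a b x : a <= clamp a b x.
Proof. by rewrite /clamp le_max lexx. Qed.

Lemma clamp_le a b x : a <= b -> clamp a b x <= b.
Proof. by move=> ab; rewrite /clamp ge_max ab ge_min lexx orbT. Qed.

Lemma clamp_id a b x : a <= x -> x <= b -> clamp a b x = x.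
Proof. by move=> ax xb; rewrite /clamp min_l // max_r. Qed.

Lemma clamp_nd a b : {homo clamp a b : x y / x <= y}.
Proof.
move=> x y xy; rewrite /clamp ge_max !le_max lexx /=; apply/orP; right.
by rewrite le_min !ge_min xy lexx /= orbT.
Qed.

Lemma clamp_lip a b x y : a <= b -> x <= y ->
  clamp a b y - clamp a b x <= y - x.
Proof.
move=> ab xy; rewrite /clamp /Num.max /Num.min.
case: ifPn; case: ifPn; case: ifPn; case: ifPn; rewrite -?leNgt; lra.
Qed.

(** * Density of a nondecreasing absolutely continuous function *)

Section nondecreasing.
Variables (a b : R) (F : R -> R).
Hypothesis ab : a <= b.
Hypothesis ndF : forall x y, a <= x -> x <= y -> y <= b -> F x <= F y.
Hypothesis acF : seq_abs_cont a b F.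

Let Fc x := F (clamp a b x).

Let ndFc : nondecreasing Fc.
Proof. by move=> x y xy; apply: ndF; [exact: clamp_ge|exact: clamp_nd|exact: clamp_le]. Qed.

Let Fc_cont : continuous Fc.
Proof.
move=> x; apply/cvgrPdist_lt => e e0; have [d d0 dF] := acF e0.
have key u v : u <= v -> v - u < d -> `|Fc v - Fc u| < e.
  move=> uv vud; have := dF [:: (clamp a b u, clamp a b v)].
  rewrite !big_seq1 /= !andbT; apply => //.
    by rewrite /sub_itv /= clamp_ge clamp_nd //= clamp_le.
  exact: le_lt_trans (clamp_lip ab uv) vud.
near=> y.
have yd : `|x - y| < d by near: y; exact: cvgr_dist_lt.
case: (leP x y) => xy; last first.
  by apply: key; [exact: ltW|exact: le_lt_trans (ler_norm _) yd].
by rewrite distrC; apply: key => //; apply: le_lt_trans (ler_norm _) _; rewrite distrC.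
Unshelve. all: by end_near. Qed.

Let cF : cumulative R R :=
  HB.pack Fc (isCumulative.Build R _ R Fc ndFc (right_continuousW Fc_cont)).

Let nu : {measure set (measurableTypeR R) -> \bar R} :=
  lebesgue_stieltjes_measure cF.

Let nu_oc x y : x <= y -> nu `]x, y]%classic = (Fc y - Fc x)%:E.
Proof.
move=> xy; rewrite /nu /= /lebesgue_stieltjes_measure /measure_extension.
by rewrite measurable_mu_extE/=; [rewrite wlength_itv_bnd|exact: is_ocitv].
Qed.

Let nuT : (nu setT < +oo)%E.
Proof.
rewrite -(bigcup_itvT false false).
pose I n : set R := `]- (n%:R), n%:R]%classic.
have cv : (nu \o I) n @[n --> \oo] --> nu (\bigcup_n I n).
  apply: nondecreasing_cvg_mu; rewrite /I//; first exact: bigcup_measurable.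
  by move=> *; apply/subsetPset/subset_itv; rewrite leBSide/= ?lerN2 ler_nat.
apply: (@le_lt_trans _ _ (F b - F a)%:E); last exact: ltry.
rewrite -(cvg_lim _ cv) //; apply: lime_le; first by apply/cvg_ex; eexists; exact: cv.
apply: nearW => n; rewrite /= /I nu_oc ?ge0_cp // lee_fin.
by apply: lerB; apply: ndF; rewrite ?clamp_ge ?clamp_le ?lexx.
Qed.

Let nu_fin : fin_num_fun nu.
Proof.
move=> A mA; rewrite ge0_fin_numE //; apply: le_lt_trans nuT.
by apply: le_measure; rewrite ?inE.
Qed.

(** Cover a null set by an open [U] of measure below [d]. The components of [U], clamped to
    [[a, b]], do not overlap, and any finitely many of them have total length below [d], hence
    [nu]-mass at most [e]. Countable additivity carries the bound to [U]. *)
Let nu_dom : nu `<< mu.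
Proof.
apply/null_content_dominatesP => N mN N0.
apply/eqP; rewrite eq_le measure_ge0 andbT; apply/lee_addgt0Pr => e e0.
rewrite add0e; have [d d0 dF] := acF e0.
have [U [oU NU muUN]] := lebesgue_regularity_outer mN (ltac:(by rewrite N0 ltry)) d0.
have muU : (mu U < d%:E)%E.
  rewrite -(setDUK NU); apply: le_lt_trans (measureU2 _ _ _) _ => //.
    by apply: measurableD => //; exact: open_measurable.
  by rewrite [X in (X + _)%E]N0 add0e.
have [I [oiI tI UE]] := OpenSetDisjointItvs.open_disjoint_itv oU.
have mI (q : nat) : measurable (I q : set (measurableTypeR R)).
  by apply: open_measurable; case: (oiI q).
have muI (q : nat) : (mu (I q) < +oo)%E.
  apply: (@le_lt_trans _ _ (mu U)); last exact: lt_trans muU (ltry _).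
  apply: le_measure; rewrite ?inE //; first exact: open_measurable.
  by rewrite UE; exact: bigcup_sup.
(* An empty component is represented by [(b, b)], which overlaps no interval of [[a, b]]. *)
have /choice[p pP] : forall q : nat, exists p : R * R, [/\ sub_itv a b p,
    (nu (I q) <= (F p.2 - F p.1)%:E)%E, ((p.2 - p.1)%:E <= mu (I q))%E &
    p = (b, b) \/ exists x y, [/\ x < y, I q = `]x, y[%classic &
       p = (clamp a b x, clamp a b y)]].
  move=> q; have [->|/set0P I0] := eqVneq (I q) set0.
    exists (b, b); rewrite /sub_itv /= ab lexx !measure0 !subrr.
    by split => //; left.
  have [x [y [xy IE]]] := open_interval_ooE (oiI q).1 (oiI q).2 I0 (muI q).
  exists (clamp a b x, clamp a b y); split => /=.
  - by rewrite /sub_itv /= clamp_ge clamp_le // clamp_nd // ltW.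
  - apply: (@le_trans _ _ (nu `]x, y]%classic)); last first.
      have -> : nu `]x, y]%classic = (F (clamp a b y) - F (clamp a b x))%:E.
        exact: nu_oc (ltW xy).
      exact: lexx.
    rewrite IE; apply: le_measure; rewrite ?inE.
    + by rewrite -IE; exact: mI.
    + exact: measurable_itv.
    + exact: subset_itv_oo_oc.
  - rewrite IE lebesgue_measure_itv /= lte_fin xy -EFinB lee_fin.
    by apply: clamp_lip => //; exact: ltW.
  - by right; exists x, y.
apply: (@le_trans _ _ (nu U)).
  by apply: le_measure; rewrite ?inE //; exact: open_measurable.
have -> : nu U = (\sum_(0 <= q <oo) nu (I q))%E.
  rewrite UE measure_bigcup //.
  by apply: eq_eseriesl => i; rewrite in_setT.
apply: lime_le; first by apply: is_cvg_nneseries.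
apply: nearW => k.
apply: (@le_trans _ _ (\sum_(0 <= q < k) (F (p q).2 - F (p q).1)%:E)%E).
  by apply: lee_sum => q _; case: (pP q).
rewrite sumEFin lee_fin.
apply: (@le_trans _ _ (\sum_(r <- map p (iota 0 k)) `|F r.2 - F r.1|)).
  rewrite big_map /index_iota subn0; apply: ler_sum => q _; exact: ler_norm.
apply/ltW/dF.
- by apply/allP => r /mapP[q _ ->]; case: (pP q).
- rewrite pairwise_map; have := iota_uniq 0 k; rewrite uniq_pairwise.
  apply: sub_pairwise => i j /= ij.
  have [si _ _ hi] := pP i; have [sj _ _ hj] := pP j.
  have {si}/and3P[_ _ si] := si; have {sj}/and3P[_ _ sj] := sj.
  case: hi => [->|[x [y [xy Ii pi]]]]; first by rewrite /nonoverlap /= sj orbT.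
  case: hj => [->|[x' [y' [xy' Ij pj]]]]; first by rewrite /nonoverlap /= si.
  rewrite pi pj /nonoverlap /=.
  have [yx'|x'y] := leP y x'; first by rewrite clamp_nd.
  have [y'x|xy0] := leP y' x; first by rewrite orbC clamp_nd.
  (* If neither component precedes the other, the midpoint of their overlap []m, M[] lies in both,
     against disjointness. *)
  have /trivIsetP/(_ i j Logic.I Logic.I ij) := tI; rewrite Ii Ij.
  pose m := Num.max x x'; pose M := Num.min y y'.
  have mM : m < M by rewrite /m /M gt_max !lt_min xy x'y xy0.
  have [mx mx'] : x <= m /\ x' <= m by rewrite /m !le_max !lexx orbT.
  have [My My'] : M <= y /\ M <= y' by rewrite /M !ge_min !lexx orbT.
  move=> /seteqP[/(_ ((m + M) / 2)) /= + _]; rewrite !in_itv /=.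
  have -> : x < (m + M) / 2 < y by apply/andP; split; lra.
  have -> : x' < (m + M) / 2 < y' by apply/andP; split; lra.
  by case.
- rewrite big_map -lte_fin -sumEFin.
  apply: le_lt_trans muU.
  apply: (@le_trans _ _ (\sum_(0 <= q < k) mu (I q))%E).
    by rewrite /index_iota subn0; apply: lee_sum => q _; case: (pP q).
  rewrite UE measure_bigcup //.
  rewrite [leRHS](_ : _ = (\sum_(0 <= q <oo) mu (I q))%E); last first.
    by apply: eq_eseriesl => i; rewrite in_setT.
  exact: nneseries_lim_ge.
Qed.

Lemma nd_density : exists2 g : R -> R, mu.-integrable setT (EFin \o g) &
  forall x, a <= x -> x <= b ->
    (F x - F a)%:E = (\int[mu]_(t in `]a, x]) (g t)%:E)%E.
Proof.
pose nuf : {finite_measure set (measurableTypeR R) -> \bar R} :=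
  HB.pack (Measure.sort nu) (Measure_isFinite.Build _ (measurableTypeR R) R nu nu_fin).
have [g [g0 gfin gint gE]] :=
  @radon_nikodym_sigma_finite _ _ _ (@lebesgue_measure R) nuf nu_dom.
have gg : EFin \o (fine \o g) = g by apply/funext => x /=; rewrite fineK.
exists (fine \o g); first by rewrite gg.
move=> x ax xb; transitivity (nu `]a, x]%classic).
  by rewrite nu_oc // /Fc !clamp_id.
rewrite [LHS]gE //; apply: eq_integral => t _ /=; by rewrite fineK.
Qed.

End nondecreasing.

End variation.

(** * Almost everywhere derivative and its integral *)

Section abs_cont_ftc.
Context {R : realType}.
Implicit Types (a b : R) (f : R -> R).
Notation mu := (@lebesgue_measure R).

(** Jordan decomposition: [f = V - (V - f)] with [V] the variation from [a]. Both terms are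
    nondecreasing because an increment of [f] is at most the corresponding increment of [V], and
    both are absolutely continuous. *)
Lemma abs_cont_itv_density a b f : a <= b -> abs_cont_itv a b f ->
  exists2 g : R -> R, mu.-integrable setT (EFin \o g) &
  forall x, a <= x -> x <= b ->
    (f x - f a)%:E = (\int[mu]_(t in `]a, x]) (g t)%:E)%E.
Proof.
move=> ab acf; pose V x := fine (total_variation a x f).
have tvab := abs_cont_tv_fin ab acf.
have acV : seq_abs_cont a b V by exact: seq_abs_cont_tv.
have acVf : seq_abs_cont a b (V \- f) by apply: seq_abs_contB => //; exact: abs_cont_seq.
have le_dV x y : a <= x -> x <= y -> y <= b -> `|f y - f x| <= V y - V x.
  by move=> ax xy yb; rewrite -lee_fin (fine_tvB tvab) // total_variation_ge.
have ndV x y : a <= x -> x <= y -> y <= b -> V x <= V y.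
  by move=> ax xy yb; rewrite -subr_ge0 (le_trans _ (le_dV _ _ ax xy yb)).
have ndVf x y : a <= x -> x <= y -> y <= b -> (V \- f) x <= (V \- f) y.
  move=> ax xy yb; have := le_dV _ _ ax xy yb; have := ler_norm (f y - f x).
  by move=> /=; lra.
have [g1 ig1 g1E] := nd_density ab ndV acV.
have [g2 ig2 g2E] := nd_density ab ndVf acVf.
exists (g1 \- g2) => [|x ax xb]; first exact: (integrableB measurableT ig1 ig2).
have subT (A : set R) (g : R -> R) : measurable A -> mu.-integrable setT (EFin \o g) ->
    mu.-integrable A (EFin \o g).
  by move=> mA; apply: integrableS.
rewrite [RHS](_ : _ = \int[mu]_(t in `]a, x]) ((EFin \o g1) t - (EFin \o g2) t))%E //.
rewrite integralB //; [|exact: subT..].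
rewrite -g1E // -g2E // -EFinB; congr _%:E => /=; lra.
Qed.

Lemma abs_cont_continuous f : abs_cont f -> continuous f.
Proof.
move=> acf x; apply/cvgrPdist_lt => e e0.
have [d d0 dP] := abs_cont_seq (acf (x - 1) (x + 1) ltac:(lra)) e0.
have key u v : x - 1 <= u -> u <= v -> v <= x + 1 -> v - u < d -> `|f v - f u| < e.
  move=> xu uv vx vud; have := dP [:: (u, v)]; rewrite !big_seq1 /= !andbT.
  by rewrite /sub_itv /= xu uv vx; apply.
near=> y.
have yd : `|x - y| < d by near: y; exact: cvgr_dist_lt.
have y1 : `|x - y| < 1 by near: y; exact: cvgr_dist_lt.
have /andP[yd1 yd2] : y - d < x < y + d by rewrite -ltr_distl.
have /andP[y11 y12] : y - 1 < x < y + 1 by rewrite -ltr_distl.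
have [xy|yx] := leP x y; last by apply: key; lra.
by rewrite distrC; apply: key; lra.
Unshelve. all: by end_near. Qed.

(* The points of differentiability are those where the difference quotients satisfy the
   Cauchy criterion; elsewhere [derive1 f] is the default value of [lim]. *)
Lemma measurable_derive1 f : continuous f -> measurable_fun setT (derive1 f).
Proof.
move=> cf; pose q (h x : R) : R := h^-1 *: (f (h + x) - f x).
have cq h : continuous (q h).
  move=> x; rewrite /q; apply: cvgZr; apply: cvgB; last exact: cf.
  apply: (@cvg_comp _ _ _ (fun x => h + x) f); last exact: cf.
  by apply: cvgD; [exact: cvg_cst|exact: cvg_id].
pose C (k n : nat) := [set x : R | forall h h', h != 0 -> `|h| < n.+1%:R^-1 ->
  h' != 0 -> `|h'| < n.+1%:R^-1 -> `|q h x - q h' x| <= k.+1%:R^-1].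
have clC k n : closed (C k n).
  rewrite (_ : C k n = \bigcap_(p in [set p : R * R | [/\ p.1 != 0, `|p.1| < n.+1%:R^-1,
    p.2 != 0 & `|p.2| < n.+1%:R^-1]]) [set x | `|q p.1 x - q p.2 x| <= k.+1%:R^-1]).
    apply: closed_bigI => -[h h'] /= _.
    apply: (@preimage_closed _ _ (fun x => `|q h x - q h' x|) [set y | y <= _]).
      by move=> x _; apply: cvg_norm; apply: cvgB; exact: cq.
    exact: closed_le.
  apply/seteqP; split => [x xC [h h'] /= [h1 h2 h3 h4]|x xC h h' h1 h2 h3 h4]; first exact: xC.
  by apply: (xC (h, h')).
pose D := \bigcap_k \bigcup_n C k n.
have mD : measurable D.
  by apply: bigcapT_measurable => k; apply: bigcupT_measurable => n; exact: closed_measurable.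
have DP x : D x <-> cvg (q h x @[h --> 0^']).
  split=> [Dx|cx].
    apply: cauchy_cvg; apply: cauchy_exP => e e0.
    have [k ke] : exists k : nat, k.+1%:R^-1 < e.
      exists (Num.truncn e^-1); rewrite invf_plt ?posrE //; exact: truncnS_gt.
    have [n _ xC] := Dx k Logic.I.
    have n0 : (0 : R) < n.+1%:R^-1 by rewrite invr_gt0.
    pose h0 : R := n.+1%:R^-1 / 2.
    have h00 : 0 < h0 by rewrite divr_gt0.
    exists (q h0 x); suff : \forall h \near 0^', ball (q h0 x) e (q h x) by [].
    near=> h; rewrite /= /ball /=; apply: le_lt_trans ke.
    apply: xC.
    - by rewrite gt_eqF.
    - by rewrite (gtr0_norm h00) /h0 ltr_pdivrMr // ltr_pMr // ltr1n //.
    - by near: h; exact: nbhs_dnbhs_neq.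
    - by near: h; exact: dnbhs0_lt.
  move=> k _; have k0 : (0:R) < k.+1%:R^-1 / 2 by rewrite divr_gt0.
  move: cx => /cvg_ex[l /cvgrPdist_lt/(_ _ k0)].
  rewrite near_withinE => /nbhs_ballP[e /= e0 eP].
  have [n ne] : exists n : nat, n.+1%:R^-1 < e.
    exists (Num.truncn e^-1); rewrite invf_plt ?posrE //; exact: truncnS_gt.
  exists n => // h h' h0 hn h'0 h'n.
  have P1 : `|l - q h x| < k.+1%:R^-1 / 2.
    by apply: eP => //; rewrite /ball /= sub0r normrN (lt_trans hn).
  have P2 : `|l - q h' x| < k.+1%:R^-1 / 2.
    by apply: eP => //; rewrite /ball /= sub0r normrN (lt_trans h'n).
  rewrite (_ : q h x - _ = (l - q h' x) - (l - q h x)); last by ring.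
  apply: le_trans (ler_normB _ _) _; rewrite [leRHS]splitr.
  by apply: lerD; exact: ltW.
rewrite -(setUv D); apply/measurable_funU => //; first exact: measurableC.
split; last first.
  apply: (@eq_measurable_fun _ _ _ _ _ (cst point)); last exact: measurable_cst.
  move=> x; rewrite inE /= => nDx; rewrite /derive1 dvgP // => cx.
  by apply: nDx; apply/DP.
(* On [D] the derivative is the pointwise limit of the continuous quotients along
   [h = 1 / (n + 1)]. *)
apply: (@measurable_fun_cvg _ _ _ _ (fun n => q n.+1%:R^-1)) => [n|x].
  apply: measurable_funTS; apply: continuous_measurable_fun; exact: cq.
move=> /DP cx; have /cvgr_dnbhsP := cx; apply; split.
  by move=> n; rewrite invr_eq0 pnatr_eq0.
exact: cvg_harmonic.
Unshelve. all: by end_near. Qed.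

Lemma abs_cont_itv_ftc f a b : a < b -> abs_cont f ->
  [/\ {ae mu, forall x, x \in `]a, b[ -> derivable f x 1},
      mu.-integrable `[a, b] (EFin \o derive1 f) &
      \int[mu]_(x in `[a, b]) (derive1 f x)%:E = (f b - f a)%:E]%E.
Proof.
move=> ab acf; have [g ig gE] := abs_cont_itv_density (ltW ab) (acf _ _ (ltW ab)).
have igA A : measurable A -> mu.-integrable A (EFin \o g).
  by move=> mA; apply: integrableS ig.
have := @FTC1 _ g (BRight a) (fun y => igA _ (measurable_itv _))
  (open_integrable_locally openT ig).
set F := fun x => _; move=> FP.
have FE x : a <= x -> x <= b -> f x = F x + f a.
  move=> ax xb; apply/eqP; rewrite -subr_eq; apply/eqP.
  by rewrite /F /Rintegral -gE.
have aef : Filter (nbhs (almost_everywhere mu)) := ae_filter_ringOfSetsType mu.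
have aeP : {ae mu, forall x, x \in `]a, b[ -> derivable f x 1 /\ derive1 f x = g x}.
  apply: filterS FP => x FP; rewrite in_itv /= => /andP[ax xb].
  have [dF dFE] := FP ax.
  (* [F + f a] coincides with [f] on [[a, b]] only, so the derivative of [F] is transferred at
     interior points. *)
  have nearE : {near x, (fun y => F y + f a) =1 f}.
    have : x \in `]a, b[ by rewrite in_itv /= ax.
    move/near_in_itvoo; apply: filterS => y; rewrite in_itv /= => /andP[ay yb].
    by rewrite (FE y (ltW ay) (ltW yb)).
  have DF : is_derive x 1 F (g x) by apply: DeriveDef; [exact: dF|rewrite -derive1E].
  have DFc : is_derive x 1 (fun y => F y + f a) (g x + 0).
    exact: (is_deriveD DF (is_derive_cst _ _ _)).
  have [df dfE] := near_eq_is_derive nearE DFc.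
  by split; [exact: df|rewrite derive1E dfE addr0].
have dg : ae_eq mu `]a, b[%classic (EFin \o derive1 f) (EFin \o g).
  by apply: filterS aeP => x + /= xab => /(_ xab)[_ ->].
have mdf : measurable_fun setT (derive1 f).
  by apply: measurable_derive1; exact: abs_cont_continuous.
(* The two endpoints form a null set. *)
have dg' : ae_eq mu `[a, b]%classic (EFin \o derive1 f) (EFin \o g).
  have neq c : {ae mu, forall x : R, x != c}.
    exists [set c]; split; [exact: measurable_set1|exact: lebesgue_measure_set1|].
    by move=> x /= /negP; rewrite negbK => /eqP.
  apply: filterS3 (neq a) (neq b) dg => x xa xb + xab; apply; move: xab.
  by rewrite /= !in_itv /= !le_eqVlt (negbTE xb) eq_sym (negbTE xa).
split.
- by apply: filterS aeP => x + /= xab => /(_ xab)[].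
- apply/integrableP; split; first by apply/measurable_EFinP/measurable_funTS.
  have /integrableP[_] := igA `[a, b]%classic (measurable_itv _).
  apply: le_lt_trans; rewrite le_eqVlt; apply/orP; left; apply/eqP.
  apply: ae_eq_integral => //.
  + by apply/measurableT_comp => //; apply/measurable_EFinP/measurable_funTS.
  + apply/measurableT_comp => //; exact: measurable_int (igA _ _).
  + exact: ae_eq_comp.
- transitivity (\int[mu]_(x in `[a, b]) (g x)%:E)%E.
    apply: ae_eq_integral => //; first by apply/measurable_EFinP/measurable_funTS.
    exact: measurable_int (igA _ _).
  rewrite (gE b (ltW ab) (lexx b)) integral_itv_obnd_cbnd //.
  exact: measurable_int (igA _ _).
Qed.

Lemma abs_cont_derivable f : abs_cont f -> {ae mu, forall x, derivable f x 1}.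
Proof.
move=> acf.
have aef : Filter (nbhs (almost_everywhere mu)) := ae_filter_ringOfSetsType mu.
have /ae_foralln : forall n : nat,
    {ae mu, forall x, x \in `](- n.+1%:R), n.+1%:R[ -> derivable f x 1}.
  by move=> n; have [] := @abs_cont_itv_ftc f (- n.+1%:R) n.+1%:R (gtrN _) acf.
apply: filterS => x /(_ (Num.truncn `|x|)); apply.
by rewrite in_itv /= -ltr_norml truncnS_gt.
Qed.

End abs_cont_ftc.

(** * Cutoffs and integration by parts on the line *)

Section c1_functions.
Context {R : realType}.
Implicit Types (a b : R) (f g : R -> R).

Lemma continuous_itv_bounded f a b : continuous f ->
  exists2 M : R, 0 < M & forall x, a <= x -> x <= b -> `|f x| <= M.
Proof.
move=> cf; have [ab|ba] := leP a b; last first.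
  by exists 1 => // x ax xb; have := lt_le_trans ba (le_trans ax xb); rewrite ltxx.
have cnf : {within `[a, b], continuous (fun x => `|f x|)}.
  by apply: continuous_subspaceT => x; apply: cvg_norm; exact: cf.
have [c _ cP] := EVT_max ab cnf.
exists (`|f c| + 1) => [|x ax xb]; first by rewrite ltr_wpDl.
by apply: le_trans (cP x _) _; rewrite ?in_itv /= ?ax ?lerDl.
Qed.

Lemma abs_contM f g : abs_cont f -> abs_cont g -> abs_cont (f \* g).
Proof.
move=> acf acg a b ab e e0.
have [M M0 fM] := continuous_itv_bounded a b (abs_cont_continuous acf).
have [N N0 gN] := continuous_itv_bounded a b (abs_cont_continuous acg).
have eN : 0 < e / (N + N) by rewrite divr_gt0 ?addr_gt0.
have eM : 0 < e / (M + M) by rewrite divr_gt0 ?addr_gt0.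
have [d d0 dP] := acf a b ab _ eN; have [d' d'0 dP'] := acg a b ab _ eM.
exists (Num.min d d'); first by rewrite lt_min d0.
move=> n u v uv no; rewrite lt_min => /andP[sd sd'].
have {}dP := dP n u v uv no sd; have {}dP' := dP' n u v uv no sd'.
apply: (@le_lt_trans _ _ (N * (\sum_(i < n) `|f (v i) - f (u i)|) +
   M * (\sum_(i < n) `|g (v i) - g (u i)|))).
  rewrite 2!mulr_sumr -big_split /=; apply: ler_sum => i _.
  have [au uv' vb] := uv i.
  rewrite (_ : _ - _ = (f (v i) - f (u i)) * g (v i) + f (u i) * (g (v i) - g (u i)));
    last by ring.
  apply: le_trans (ler_normD _ _) _; rewrite !normrM; apply: lerD.
    by rewrite mulrC ler_wpM2r // gN // (le_trans au).
  by rewrite ler_wpM2r // fM // (le_trans uv').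
rewrite [ltRHS]splitr; apply: ltrD.
  by move: dP; rewrite ltr_pdivlMr ?addr_gt0 //; nra.
by move: dP'; rewrite ltr_pdivlMr ?addr_gt0 //; nra.
Qed.

Lemma is_derive_continuous f f' : (forall x : R, is_derive x (1 : R) f (f' x)) -> continuous f.
Proof.
move=> df x; apply: differentiable_continuous; apply/derivable1_diffP.
by have [] := df x.
Qed.

Lemma c1_abs_cont f f' : (forall x : R, is_derive x (1 : R) f (f' x)) -> continuous f' ->
  abs_cont f.
Proof.
move=> df cf' a b ab e e0.
have [M M0 fM] := continuous_itv_bounded a b cf'.
exists (e / M); first by rewrite divr_gt0.
move=> n u v uv _ sd.
apply: (@le_lt_trans _ _ (M * \sum_(i < n) (v i - u i))); last first.
  by rewrite mulrC -ltr_pdivlMr.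
rewrite mulr_sumr; apply: ler_sum => i _; have [au uv' vb] := uv i.
have [|c cuv ->] := @MVT_segment _ f f' _ _ uv' (fun x _ => df x).
  by apply: continuous_subspaceT; exact: is_derive_continuous df.
move: cuv; rewrite in_itv /= => /andP[uc cv].
rewrite normrM (ger0_norm (x := v i - u i)) ?subr_ge0 // ler_wpM2r ?subr_ge0 // fM //.
  exact: le_trans uc.
exact: le_trans vb.
Qed.

(** At 0 the difference quotient of the squared positive part is the positive part itself, which is
    continuous there. This is what makes the cutoffs C^1. *)
Lemma is_derive_max0_sqr (x : R) :
  is_derive x (1 : R) (fun y : R => Num.max 0 y ^+ 2) (2 * Num.max 0 x).
Proof.
have [x0|x0|->] := ltgtP x 0.
- rewrite mulr0.
  have nE : \forall y \near x, cst 0 y = Num.max 0 y ^+ 2.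
    near=> y; rewrite /cst max_l ?expr0n //; apply: ltW.
    by near: y; exact: lt_nbhsl.
  exact: near_eq_is_derive nE (is_derive_cst _ _ _).
-   have nE : \forall y \near x, y ^+ 2 = Num.max 0 y ^+ 2.
    near=> y; rewrite max_r //; apply: ltW.
    by near: y; exact: lt_nbhsr.
  apply: (near_eq_is_derive nE).
  by apply: is_derive_eq; rewrite /GRing.scale /=; ring.
- rewrite mulr0; apply/is_derive1_caratheodory.
  exists (fun z => Num.max 0 z); split; last by rewrite maxxx.
    move=> z; rewrite maxxx expr0n subr0 subr0 expr2.
    by rewrite /Num.max; case: ifP => // _; rewrite !mul0r.
  by apply: continuous_max; [exact: cst_continuous|exact: id].
Unshelve. all: by end_near. Qed.


Implicit Type n : nat.

(** The positive part of [1 - x^2 / (n + 1)^2] has corners at the two ends of its support; [cutoff]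
    squares it to be C^1, as a test function must be, and [dcutoff] is the derivative of [cutoff].
    The scale [n.+1] is never zero. *)
Definition cutoff_root n (x : R) := Num.max 0 (1 - x ^+ 2 / n.+1%:R ^+ 2).

Definition cutoff n x := cutoff_root n x ^+ 2.

Definition dcutoff n x := - (4 * x / n.+1%:R ^+ 2 * cutoff_root n x).

Lemma continuous_max0 : continuous (fun y : R => Num.max 0 y).
Proof.
move=> y; have c0 : {for y, continuous (cst 0 : R -> R^o)} by exact: cst_continuous.
have ci : {for y, continuous (id : R -> R^o)} by exact: cvg_id.
exact: (continuous_max c0 ci).
Qed.

Lemma cutoff_root_ge0 n x : 0 <= cutoff_root n x.
Proof. by rewrite /cutoff_root le_max lexx. Qed.

Lemma cutoff_root_le1 n x : cutoff_root n x <= 1.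
Proof.
by rewrite /cutoff_root ge_max ler01 /= gerBl divr_ge0 // ?sqr_ge0.
Qed.

Lemma cutoff_root_out n x : n.+1%:R <= `|x| -> cutoff_root n x = 0.
Proof.
move=> nx; rewrite /cutoff_root max_l // subr_le0 ler_pdivlMr ?exprn_gt0 //.
by rewrite mul1r -(real_normK (num_real x)) ler_sqr ?nnegrE.
Qed.

Lemma cutoff_root_bound n x : `|x| * cutoff_root n x <= n.+1%:R.
Proof.
have [nx|xn] := leP n.+1%:R `|x|; first by rewrite cutoff_root_out // mulr0.
rewrite -[leRHS]mulr1; apply: ler_pM => //; first exact: cutoff_root_ge0.
  exact: ltW.
exact: cutoff_root_le1.
Qed.

Lemma is_derive_cutoff n (x : R) : is_derive x (1 : R) (cutoff n) (dcutoff n x).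
Proof.
pose u := fun x : R => 1 - x ^+ 2 / n.+1%:R ^+ 2.
have du : is_derive x (1 : R) u (- (2 * x / n.+1%:R ^+ 2)).
  rewrite /u; apply: is_derive_eq; rewrite /GRing.scale /=; ring.
have := is_derive1_comp (is_derive_max0_sqr (u x)) du.
move=> H; apply: (is_derive_eq H).
by rewrite /dcutoff /cutoff_root -/(u x); ring.
Qed.

Lemma continuous_cutoff_root n : continuous (cutoff_root n).
Proof.
move=> x; apply: (@cvg_comp _ _ _ (fun x : R => 1 - x ^+ 2 / n.+1%:R ^+ 2)
  (fun y => Num.max 0 y)); last exact: continuous_max0.
apply: cvgB; first exact: cvg_cst.
by apply: cvgM; [exact: exprn_continuous|exact: cvg_cst].
Qed.

Lemma continuous_dcutoff n : continuous (dcutoff n).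
Proof.
move=> x; apply: cvgN; apply: cvgM; last exact: continuous_cutoff_root.
apply: cvgM; last exact: cvg_cst.
by apply: cvgM; [exact: cvg_cst|exact: cvg_id].
Qed.

Lemma cvg_cutoff_root x : cutoff_root n x @[n --> \oo] --> (1 : R).
Proof.
have h : (n.+1%:R : R)^-1 @[n --> \oo] --> (0 : R) by exact: cvg_harmonic.
have -> : (1 : R) = Num.max 0 (1 - x ^+ 2 * 0 ^+ 2) by rewrite expr0n mulr0 subr0 max_r.
have cm : continuous (fun y : R => Num.max 0 (1 - x ^+ 2 * y ^+ 2)).
  move=> y; apply: (@cvg_comp _ _ _ (fun y : R => 1 - x ^+ 2 * y ^+ 2)
    (fun y => Num.max 0 y)); last exact: continuous_max0.
  apply: cvgB; first exact: cvg_cst.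
  by apply: cvgM; [exact: cvg_cst|exact: exprn_continuous].
have := @cvg_comp _ _ _ _ _ _ _ _ h (cm 0).
by apply: cvg_trans; apply: near_eq_cvg; apply: nearW => n; rewrite /= /cutoff_root exprVn.
Qed.

Lemma cvg_cutoff x : cutoff n x @[n --> \oo] --> (1 : R).
Proof.
rewrite -(expr1n _ 2); under eq_fun do rewrite /cutoff expr2.
by rewrite expr2; apply: cvgM; exact: cvg_cutoff_root.
Qed.

Lemma cvg_dcutoff x : dcutoff n x @[n --> \oo] --> (0 : R).
Proof.
have h : (n.+1%:R : R)^-1 @[n --> \oo] --> (0 : R) by exact: cvg_harmonic.
have -> : (0 : R) = - (4 * x * (0 * 0) * 1) by rewrite !(mulr0, mul0r) oppr0.
rewrite /dcutoff; apply: cvgN; apply: cvgM; last exact: cvg_cutoff_root.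
apply: cvgM; first exact: cvg_cst.
by under eq_fun do rewrite expr2 invfM; apply: cvgM.
Qed.

Lemma dcutoff_out n x : n.+1%:R <= `|x| -> dcutoff n x = 0.
Proof. by move=> nx; rewrite /dcutoff cutoff_root_out // mulr0 oppr0. Qed.

(** The factor [|x|] of the derivative is at most [n + 1] on the support and cancels one of the two
    powers of [n + 1] in the denominator. *)
Lemma dcutoff_bound n x : `|dcutoff n x| <= 4 / n.+1%:R.
Proof.
rewrite /dcutoff normrN 3!normrM (ger0_norm (cutoff_root_ge0 n x)) (ger0_norm (x := 4)) //.
rewrite (ger0_norm (x := _^-1)) ?invr_ge0 ?exprn_ge0 //.
have -> : 4 * `|x| / n.+1%:R ^+ 2 * cutoff_root n x =
    4 / n.+1%:R * (`|x| * cutoff_root n x / n.+1%:R).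
  by field; rewrite nat1r pnatr_eq0.
by rewrite ler_piMr ?divr_ge0 // ler_pdivrMr // mul1r cutoff_root_bound.
Qed.

(** The bound is uniform in [n], as domination requires when [w] grows linearly: on the support
    [1 + |x|] is at most [2 (n + 1)], and 8 is 2 times the 4 of [dcutoff_bound]. *)
Lemma dcutoff_lin n x : (1 + `|x|) * `|dcutoff n x| <= 8.
Proof.
have [nx|xn] := leP n.+1%:R `|x|; first by rewrite dcutoff_out // normr0 mulr0.
apply: (@le_trans _ _ ((n.+1%:R + n.+1%:R) * (4 / n.+1%:R))).
  apply: ler_pM; rewrite ?dcutoff_bound ?addr_ge0 //.
  by apply: lerD; [rewrite ler1n|exact: ltW].
by rewrite le_eqVlt; apply/orP; left; apply/eqP; field; rewrite nat1r pnatr_eq0.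
Qed.

Lemma cutoff_ge0 n x : 0 <= cutoff n x.
Proof. exact: sqr_ge0. Qed.

Lemma cutoff_le1 n x : cutoff n x <= 1.
Proof. by rewrite /cutoff expr_le1 ?cutoff_root_le1 ?cutoff_root_ge0. Qed.

End c1_functions.

(** * Integration by parts on the whole line *)

Section integration_by_parts_line.
Context {R : realType}.
Notation mu := (@lebesgue_measure R).

Lemma derive1_mul (f g : R -> R) (x dg : R) : derivable f x 1 ->
  is_derive x (1 : R) g dg ->
  derive1 (f \* g) x = derive1 f x * g x + f x * dg.
Proof.
move=> df Dg; have df' : is_derive x (1 : R) f (derive1 f x).
  by apply: DeriveDef => //; rewrite derive1E.
have [_ H] := is_deriveM df' Dg.
by rewrite derive1E H /GRing.scale /=; ring.
Qed.

(* The derivative of [p w (cutoff n)], which has compact support, integrates to zero; let [n]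
   go to infinity. *)
Lemma integration_by_parts_line (p w w' : R -> R) (C : R) :
  abs_cont p -> mu.-integrable setT (EFin \o p) ->
  (forall x : R, is_derive x (1 : R) w (w' x)) -> continuous w' ->
  (forall x, `|w x| <= 1 + `|x|) -> (forall x, `|w' x| <= C) ->
  mu.-integrable setT (EFin \o (fun x => w x * derive1 p x)) ->
  (\int[mu]_x (w x * derive1 p x + w' x * p x)%:E = 0)%E.
Proof.
move=> acp ip dw cw' wb w'b iwp.
pose v n x := w x * cutoff n x.
pose v' n x := w' x * cutoff n x + w x * dcutoff n x.
have dv n (x : R) : is_derive x (1 : R) (v n) (v' n x).
  have := is_deriveM (dw x) (is_derive_cutoff n x); move=> H.
  by apply: (is_derive_eq H); rewrite /v' /GRing.scale /=; ring.
have cw : continuous w by exact: is_derive_continuous dw.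
have ccut n : continuous (cutoff n) by exact: is_derive_continuous (is_derive_cutoff n).
have cv' n : continuous (v' n).
  by move=> x; apply: cvgD; apply: cvgM;
    [exact: cw'|exact: ccut|exact: cw|exact: continuous_dcutoff].
have mp' := measurable_derive1 (abs_cont_continuous acp).
have mC (f : R -> R) : continuous f -> measurable_fun setT f.
  exact: continuous_measurable_fun.
have mp : measurable_fun setT p by apply: mC; exact: abs_cont_continuous.
pose G n x := v n x * derive1 p x + v' n x * p x.
have mG n : measurable_fun setT (G n).
  apply: measurable_funD; apply: measurable_funM => //; apply: mC => //.
  exact: is_derive_continuous (dv n).
have Gout n x : n.+1%:R <= `|x| -> G n x = 0.
  move=> nx; rewrite /G /v /v' /cutoff cutoff_root_out // dcutoff_out //.
  by rewrite expr0n !mulr0 addr0 !mul0r addr0.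
have G0 n : (\int[mu]_x (G n x)%:E = 0)%E.
  have ac : abs_cont (p \* v n) by apply: abs_contM => //; exact: c1_abs_cont (dv n) (cv' n).
  have nn : - n.+1%:R < n.+1%:R :> R by rewrite gtrN.
  have [_ _ ftc] := abs_cont_itv_ftc nn ac.
  transitivity (\int[mu]_(x in `[(- n.+1%:R)%R, n.+1%:R%R]) (G n x)%:E)%E.
    rewrite [RHS]integral_mkcond; apply: eq_integral => x _; rewrite patchE.
    case: ifPn => //; rewrite notin_setE /= in_itv /= => /negP.
    by rewrite -ler_norml -ltNge => /ltW/Gout ->.
  transitivity (\int[mu]_(x in `[(- n.+1%:R)%R, n.+1%:R%R]) (derive1 (p \* v n) x)%:E)%E.
    apply: ae_eq_integral => //.
    - by apply/measurable_EFinP/measurable_funTS; exact: mG.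
    - apply/measurable_EFinP/measurable_funTS.
      by apply: measurable_derive1; exact: abs_cont_continuous.
    - have aef : Filter (nbhs (almost_everywhere mu)) := ae_filter_ringOfSetsType mu.
      apply: filterS (abs_cont_derivable acp) => x dp _ /=; congr EFin.
      by rewrite (derive1_mul dp (dv n x)) /G; ring.
  rewrite ftc /= /v /cutoff 2?cutoff_root_out ?normrN ?normr_nat //.
  by rewrite expr0n !mulr0 subrr.
have C0 : 0 <= C by exact: le_trans (w'b 0).
(* In the coefficient of [|p x|], [C] bounds [w'] times the cutoff and 8 bounds [w] times its
   derivative, by [dcutoff_lin]. *)
pose D x := `|w x * derive1 p x| + (C + 8) * `|p x|.
have GD n x : `|G n x| <= D x.
  rewrite /G /D; apply: le_trans (ler_normD _ _) _; apply: lerD.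
    rewrite /v mulrAC normrM ler_piMr // ger0_norm ?cutoff_le1 ?cutoff_ge0 //.
  rewrite normrM ler_wpM2r // /v'; apply: le_trans (ler_normD _ _) _; apply: lerD.
    rewrite normrM -[leRHS]mulr1; apply: ler_pM => //.
    by rewrite ger0_norm ?cutoff_le1 ?cutoff_ge0.
  rewrite normrM; apply: le_trans (dcutoff_lin n x); rewrite ler_wpM2r //.
have cvG x : G n x @[n --> \oo] --> w x * derive1 p x + w' x * p x.
  have -> : w x * derive1 p x + w' x * p x =
     (w x * 1) * derive1 p x + (w' x * 1 + w x * 0) * p x by ring.
  apply: cvgD; apply: cvgM; try exact: cvg_cst.
    by apply: cvgM; [exact: cvg_cst|exact: cvg_cutoff].
  by apply: cvgD; apply: cvgM; try exact: cvg_cst; [exact: cvg_cutoff|exact: cvg_dcutoff].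
have iD : mu.-integrable setT (EFin \o D).
  rewrite (_ : EFin \o D = (fun x => `|(w x * derive1 p x)%:E| + (C + 8)%:E * `|(p x)%:E|)%E);
    last by apply/funext.
  apply: integrableD => //; first exact: integrable_abse.
  by apply: integrableZl => //; exact: integrable_abse.
have H : (\int[mu]_x (G n x)%:E)%E @[n --> \oo] -->
    (\int[mu]_x (w x * derive1 p x + w' x * p x)%:E)%E.
  apply: (@dominated_cvg _ _ _ mu setT measurableT (fun n x => (G n x)%:E) _ (EFin \o D)) => //.
  - by move=> n; apply/measurable_EFinP; exact: mG.
  - by move=> x _; apply: cvg_EFin; [exact: nearW|exact: cvG].
  - by move=> n x _; rewrite /= lee_fin.
rewrite -(cvg_lim _ H) //.
have -> : (fun n => \int[mu]_x (G n x)%:E)%E = (fun=> 0%E) by apply/funext => n; exact: G0.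
exact: lim_cst.
Qed.

End integration_by_parts_line.

(** * Densities, couplings and the Wasserstein distance *)

Section affine_change_of_variables.
Context {R : realType}.
Notation mu := (@lebesgue_measure R).
Variables (m s : R).
Hypothesis s0 : 0 < s.

Let T (y : R) : R := m + s * y.

Let mT : measurable_fun setT T.
Proof.
apply: continuous_measurable_fun => y; apply: cvgD; first exact: cvg_cst.
by apply: cvgM; [exact: cvg_cst|exact: cvg_id].
Qed.

Let nu : {measure set (measurableTypeR R) -> \bar R} :=
  @measure_function_pushforward__canonical__measure_function_Measure
    _ _ (measurableTypeR R) (measurableTypeR R) R mu T mT.

Let sn : {nonneg R} := NngNum (ltW s0).

(** Both measures give a half-open interval its length, and Lebesgue measure is the only one that
    does. *)
Let lebesgueE (A : set (measurableTypeR R)) : measurable A ->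
  mu A = mscale sn nu A.
Proof.
apply: (@lebesgue_measure_unique _ (mscale sn nu)).
move=> X /ocitvP[->|[[a b] /= ab ->]]; first by rewrite !measure0.
rewrite /mscale /= /pushforward /=.
have -> : T @^-1` `]a, b] = `](a - m) / s, (b - m) / s]%classic.
  apply/seteqP; split => y /=; rewrite !in_itv /= /T.
    by rewrite ltr_pdivrMr // ler_pdivlMr // ltrBlDl lerBrDl (mulrC y).
  by rewrite ltr_pdivrMr // ler_pdivlMr // ltrBlDl lerBrDl (mulrC y).
rewrite !lebesgue_measure_itv /= !lte_fin ab ltr_pM2r ?invr_gt0 // ltrD2r ab.
by rewrite -!EFinB -EFinM; congr EFin; field; rewrite gt_eqF.
Qed.

Lemma ge0_integral_affine (F : R -> \bar R) : measurable_fun setT F ->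
  (forall x, 0 <= F x)%E ->
  (\int[mu]_x F x = s%:E * \int[mu]_y F (m + s * y)%R)%E.
Proof.
move=> mF F0.
rewrite (eq_measure_integral (mscale sn nu));
  last by move=> A mA _; exact: lebesgueE.
rewrite ge0_integral_mscale //; congr (_ * _)%E.
by rewrite ge0_integral_pushforward.
Qed.

End affine_change_of_variables.

Section density.
Context {R : realType}.
Notation mu := (@lebesgue_measure R).
Variable p : R -> R.
Hypothesis mp : measurable_fun setT p.
Hypothesis p0 : forall x, 0 <= p x.
Hypothesis p1 : (\int[mu]_x (p x)%:E = 1)%E.

Let law0 : law p set0 = 0%E.
Proof. by rewrite /law integral_set0. Qed.

Let law_ge0 A : (0 <= law p A)%E.
Proof. by apply: integral_ge0 => x _; rewrite lee_fin. Qed.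

Let law_sigma_additive : semi_sigma_additive (law p).
Proof.
move=> /= A mA tA mUA; rewrite /law /= ge0_integral_bigcup //=.
- apply: is_cvg_ereal_nneg_natsum_cond => n _ _.
  by apply: integral_ge0 => x _; rewrite lee_fin.
- by apply/measurable_EFinP/measurable_funTS.
- by move=> x _; rewrite lee_fin.
Qed.

Let law_measure : {measure set (measurableTypeR R) -> \bar R} :=
  HB.pack (law p) (isMeasure.Build _ _ _ (law p) law0 law_ge0 law_sigma_additive).

Definition law_prob : probability (measurableTypeR R) R :=
  HB.pack (Measure.sort law_measure)
    (Measure_isProbability.Build _ _ _ law_measure p1).

Let law_dom : law_prob `<< mu.
Proof.
apply/null_content_dominatesP => A mA A0.
by apply: null_set_integral => //; apply/measurable_EFinP/measurable_funTS.
Qed.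

(** The Radon-Nikodym derivative of [law_prob] equals [p] almost everywhere, since the two have the
    same integral over every measurable set. *)
Lemma ge0_integral_law (h : R -> \bar R) : measurable_fun setT h ->
  (forall x, 0 <= h x)%E ->
  (\int[law_prob]_x h x = \int[mu]_x (h x * (p x)%:E))%E.
Proof.
move=> mh h0.
rewrite -(Radon_Nikodym_SigmaFinite.change_of_variables law_dom h0) //.
have fint := Radon_Nikodym_SigmaFinite.f_integrable law_dom.
apply: ae_eq_integral => //.
- by apply: emeasurable_funM => //; exact: measurable_int fint.
- by apply: emeasurable_funM => //; apply/measurable_EFinP.
- apply: ae_eqe_mul2l; apply: integral_ae_eq => //; first exact/measurable_EFinP.
  by move=> E _ mE; rewrite -(Radon_Nikodym_SigmaFinite.f_integral law_dom).
Qed.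

End density.

Section location_scale.
Context {R : realType}.
Notation mu := (@lebesgue_measure R).

Lemma ge0_integrable (f : R -> R) : measurable_fun setT f -> (forall x, 0 <= f x) ->
  (\int[mu]_x (f x)%:E < +oo)%E -> mu.-integrable setT (EFin \o f).
Proof.
move=> mf f0 fi; apply/integrableP; split; first exact/measurable_EFinP.
by under eq_integral do rewrite /= ger0_norm //.
Qed.

Lemma le_integrable_fun (f g : R -> R) : measurable_fun setT f ->
  (forall x, `|f x| <= g x) -> mu.-integrable setT (EFin \o g) ->
  mu.-integrable setT (EFin \o f).
Proof.
move=> mf fg; apply: le_integrable => //; first exact/measurable_EFinP.
move=> x _ /=; rewrite lee_fin (le_trans (fg x)) //; exact: ler_norm.
Qed.

Variable phi : R -> R.
Hypothesis hphi : standard_profile phi.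

Lemma profile_measurable : measurable_fun setT phi.
Proof.
by apply: continuous_measurable_fun; apply: abs_cont_continuous; case: hphi.
Qed.

Lemma profile_ge0 x : 0 <= phi x.
Proof. by apply/ltW; case: hphi. Qed.

Lemma profile_integrable : mu.-integrable setT (EFin \o phi).
Proof.
apply: ge0_integrable; [exact: profile_measurable|exact: profile_ge0|].
by rewrite (sp_mass hphi) ltry.
Qed.

Lemma profile_integrable2 : mu.-integrable setT (EFin \o (fun x => x ^+ 2 * phi x)).
Proof.
apply: ge0_integrable.
- by apply: measurable_funM; [exact: measurable_funX|exact: profile_measurable].
- by move=> x; rewrite mulr_ge0 ?sqr_ge0 ?profile_ge0.
- by rewrite (sp_var hphi) ltry.
Qed.

Lemma profile_integrable1 : mu.-integrable setT (EFin \o (fun x => x * phi x)).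
Proof.
apply: (@le_integrable_fun _ (fun x => phi x + x ^+ 2 * phi x)).
- by apply: measurable_funM => //; exact: profile_measurable.
- move=> x; rewrite normrM (ger0_norm (profile_ge0 x)) -[X in X + _]mul1r -mulrDl.
  rewrite ler_wpM2r ?profile_ge0 // -(real_normK (num_real x)).
  have := sqr_ge0 (`|x| - 1); have := normr_ge0 x; nra.
- rewrite (_ : _ \o _ = ((EFin \o phi) \+ (EFin \o (fun x => (x ^+ 2 * phi x)%R)))%E) //.
  by apply: integrableD => //; [exact: profile_integrable|exact: profile_integrable2].
Qed.

(** Mass 1 and variance 1 give the two squares, mean 0 removes the cross term. The cost of the
    affine coupling, its lower bound and the energy of the affine field all reduce to this
    formula. *)
Lemma profile_quad_moment (a b : R) :
  (\int[mu]_y ((a + b * y) ^+ 2 * phi y)%:E = (a ^+ 2 + b ^+ 2)%:E)%E.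
Proof.
transitivity (\int[mu]_y ((a ^+ 2)%:E * (phi y)%:E +
   ((2 * a * b)%:E * (y * phi y)%:E + (b ^+ 2)%:E * (y ^+ 2 * phi y)%:E)))%E.
  by apply: eq_integral => y _; rewrite -!EFinM -!EFinD; congr EFin; ring.
have i0 := integrableZl measurableT (a ^+ 2) profile_integrable.
have i1 := integrableZl measurableT (2 * a * b) profile_integrable1.
have i2 := integrableZl measurableT (b ^+ 2) profile_integrable2.
rewrite integralD //; last exact: integrableD.
rewrite integralD // !integralZl //;
  [|exact: profile_integrable2|exact: profile_integrable1|exact: profile_integrable].
by rewrite (sp_mass hphi) (sp_mean hphi) (sp_var hphi) mule0 !mule1 add0e -EFinD.
Qed.

Variable x : 'rV[R]_2.
Hypothesis hx : half_plane x.
Notation m := (x 0 0).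
Notation s := (x 0 1).

Lemma locscale_measurable : measurable_fun setT (locscale phi x).
Proof.
apply: measurable_funM => //; apply: (measurableT_comp profile_measurable).
by apply: measurable_funM => //; apply: measurable_funB.
Qed.

Lemma locscale_ge0 z : 0 <= locscale phi x z.
Proof. by rewrite /locscale mulr_ge0 ?profile_ge0 // invr_ge0 ltW. Qed.

Lemma ge0_integral_locscale (h : R -> \bar R) : measurable_fun setT h ->
  (forall z, 0 <= h z)%E ->
  (\int[mu]_z (h z * (locscale phi x z)%:E) =
   \int[mu]_y (h (m + s * y)%R * (phi y)%:E))%E.
Proof.
move=> mh h0; have s0 : 0 < s := hx.
rewrite (@ge0_integral_affine _ m s) //; last 2 first.
- by apply: emeasurable_funM => //; apply/measurable_EFinP; exact: locscale_measurable.
- by move=> z; rewrite mule_ge0 // lee_fin locscale_ge0.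
have mT : measurable_fun setT (fun y : R => m + s * y).
  by apply: measurable_funD => //; apply: measurable_funM.
rewrite -ge0_integralZl //; last 3 first.
- apply: emeasurable_funM; first exact: (measurableT_comp mh mT).
  by apply/measurable_EFinP; apply: (measurableT_comp locscale_measurable mT).
- by move=> y _; rewrite mule_ge0 // lee_fin locscale_ge0.
- by rewrite lee_fin ltW.
apply: eq_integral => y _; rewrite muleCA -EFinM; congr (_ * EFin _)%E.
rewrite /locscale (_ : (m + s * y - m) / s = y); first by field; rewrite gt_eqF.
by field; rewrite gt_eqF.
Qed.

Lemma locscale_mass : (\int[mu]_z (locscale phi x z)%:E = 1)%E.
Proof.
have := @ge0_integral_locscale (cst 1%E) (measurable_cst _) (fun=> lee01).
under eq_integral do rewrite mul1e; under [in RHS]eq_integral do rewrite mul1e.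
by rewrite (sp_mass hphi).
Qed.

Lemma locscale_quad_moment (a b : R) :
  (\int[mu]_z (((a + b * z) ^+ 2)%:E * (locscale phi x z)%:E) =
   ((a + b * m) ^+ 2 + (b * s) ^+ 2)%:E)%E.
Proof.
rewrite (@ge0_integral_locscale (fun z => ((a + b * z) ^+ 2)%:E)).
- rewrite -(profile_quad_moment (a + b * m) (b * s)); apply: eq_integral => y _.
  by rewrite -EFinM; congr EFin; congr (_ ^+ 2 * _); ring.
- apply/measurable_EFinP; apply: measurable_funX.
  by apply: measurable_funD => //; apply: measurable_funM.
- by move=> z; rewrite lee_fin sqr_ge0.
Qed.

End location_scale.

(** * The Wasserstein distance within the family *)

Section wasserstein.
Context {R : realType}.
Notation mu := (@lebesgue_measure R).
Notation T := (measurableTypeR R).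

(** Meant for the two projections [X]: the integral over a coupling of a function of one variable
    depends only on that marginal. *)
Lemma ge0_integral_marginal (X : T * T -> T) (p : R -> R)
    (g : probability (T * T)%type R) (h : R -> \bar R) :
  measurable_fun setT X -> measurable_fun setT p -> (forall x, 0 <= p x) ->
  (\int[mu]_x (p x)%:E = 1)%E ->
  (forall A, measurable A -> g (X @^-1` A) = law p A) ->
  measurable_fun setT h -> (forall x, 0 <= h x)%E ->
  (\int[g]_z h (X z) = \int[mu]_x (h x * (p x)%:E))%E.
Proof.
move=> mX mp p0 p1 gX mh h0.
rewrite -(ge0_integral_law mp p0 p1) //.
rewrite [LHS](_ : _ = \int[g]_(z in X @^-1` setT) (h \o X) z)%E //.
rewrite -(ge0_integral_pushforward mX) //.
by apply: eq_measure_integral => A mA _; exact: gX.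
Qed.

Variable phi : R -> R.
Hypothesis hphi : standard_profile phi.

Lemma coupling_cost_ge (x y : 'rV[R]_2) (g : probability (T * T)%type R) :
  half_plane x -> half_plane y ->
  coupling (law (locscale phi x)) (law (locscale phi y)) g ->
  ((euclid_dist x y ^+ 2)%:E <= \int[g]_z ((z.1 - z.2) ^+ 2)%:E)%E.
Proof.
move=> hx hy cg; have sx : 0 < x 0 1 := hx; have sy : 0 < y 0 1 := hy.
(* [r] is the slope of the affine map carrying the first law to the second. Along that map the
   centred variables satisfy [r a = b], so AM-GM with this weight is an equality on the affine
   coupling. *)
pose d := x 0 0 - y 0 0; pose r := y 0 1 / x 0 1.
have r0 : 0 < r by rewrite divr_gt0.
have marg1 (h : R -> R) : measurable_fun setT h -> (forall z, 0 <= h z) ->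
    (\int[g]_z (h z.1)%:E = \int[mu]_z ((h z)%:E * (locscale phi x z)%:E))%E.
  move=> mh h0; apply: (@ge0_integral_marginal fst _ _ (EFin \o h)) => //.
  - exact: locscale_measurable.
  - exact: locscale_ge0.
  - exact: locscale_mass.
  - move=> A mA; have [<- _] := cg _ mA; congr (g _).
    by apply/seteqP; split => z //= [].
  - exact/measurable_EFinP.
have marg2 (h : R -> R) : measurable_fun setT h -> (forall z, 0 <= h z) ->
    (\int[g]_z (h z.2)%:E = \int[mu]_z ((h z)%:E * (locscale phi y z)%:E))%E.
  move=> mh h0; apply: (@ge0_integral_marginal snd _ _ (EFin \o h)) => //.
  - exact: locscale_measurable.
  - exact: locscale_ge0.
  - exact: locscale_mass.
  - move=> A mA; have [_ <-] := cg _ mA; congr (g _).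
    by apply/seteqP; split => z //= [].
  - exact/measurable_EFinP.
have mq (a b c : R) : measurable_fun setT (fun z : R => c * (a + b * z) ^+ 2).
  apply: measurable_funM => //; apply: measurable_funX.
  by apply: measurable_funD => //; apply: measurable_funM.
have q0 (a b c : R) : 0 <= c -> forall z : R, 0 <= c * (a + b * z) ^+ 2.
  by move=> c0 z; rewrite mulr_ge0 ?sqr_ge0.
have m1 (a b c : R) : 0 <= c -> (\int[g]_z (c * (a + b * z.1) ^+ 2)%:E =
    (c * ((a + b * x 0 0) ^+ 2 + (b * x 0 1) ^+ 2))%:E)%E.
  move=> c0; rewrite (marg1 _ (mq a b c) (q0 a b c c0)).
  under eq_integral do rewrite EFinM -muleA.
  rewrite ge0_integralZl ?lee_fin //.
  - by rewrite (locscale_quad_moment hphi hx).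
  - apply: emeasurable_funM; apply/measurable_EFinP; last exact: locscale_measurable.
    by have := mq a b 1; under eq_fun do rewrite mul1r.
  - by move=> z _; rewrite mule_ge0 // lee_fin ?sqr_ge0 ?locscale_ge0.
have m2 (a b c : R) : 0 <= c -> (\int[g]_z (c * (a + b * z.2) ^+ 2)%:E =
    (c * ((a + b * y 0 0) ^+ 2 + (b * y 0 1) ^+ 2))%:E)%E.
  move=> c0; rewrite (marg2 _ (mq a b c) (q0 a b c c0)).
  under eq_integral do rewrite EFinM -muleA.
  rewrite ge0_integralZl ?lee_fin //.
  - by rewrite (locscale_quad_moment hphi hy).
  - apply: emeasurable_funM; apply/measurable_EFinP; last exact: locscale_measurable.
    by have := mq a b 1; under eq_fun do rewrite mul1r.
  - by move=> z _; rewrite mule_ge0 // lee_fin ?sqr_ge0 ?locscale_ge0.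
(* AM-GM for the product of the centred variables [a = z.1 - x 0 0] and [b = z.2 - y 0 0]:
   [(a + d) ^ 2 + (b - d) ^ 2 <= (a - b + d) ^ 2 + r a ^ 2 + b ^ 2 / r + d ^ 2]. *)
have ptw (z : T * T) : 1 * (- y 0 0 + 1 * z.1) ^+ 2 + 1 * (- x 0 0 + 1 * z.2) ^+ 2 <=
    (z.1 - z.2) ^+ 2 + (r * (- x 0 0 + 1 * z.1) ^+ 2
     + (r^-1 * (- y 0 0 + 1 * z.2) ^+ 2 + d ^+ 2)).
  set L := (X in X <= _); set U := (X in _ <= X).
  have -> : U = L + r^-1 * (r * (z.1 - x 0 0) - (z.2 - y 0 0)) ^+ 2.
    by rewrite /U /L /d; field; rewrite gt_eqF.
  by rewrite lerDl mulr_ge0 ?sqr_ge0 // invr_ge0 ltW.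
have mz1 (a b c : R) : measurable_fun setT (fun z : T * T => (c * (a + b * z.1) ^+ 2)%:E).
  by apply/measurable_EFinP; apply: (measurableT_comp (mq a b c)).
have mz2 (a b c : R) : measurable_fun setT (fun z : T * T => (c * (a + b * z.2) ^+ 2)%:E).
  by apply/measurable_EFinP; apply: (measurableT_comp (mq a b c)).
have mc : measurable_fun setT (fun z : T * T => ((z.1 - z.2) ^+ 2)%:E).
  by apply/measurable_EFinP; apply: measurable_funX; apply: measurable_funB.
(* With the terms arranged so that every summand is nonnegative, both integrals split into sums even
   if [g] has infinite cost. *)
have : (\int[g]_z ((1 * (- y 0 0 + 1 * z.1) ^+ 2)%:E + (1 * (- x 0 0 + 1 * z.2) ^+ 2)%:E) <=
  \int[g]_z (((z.1 - z.2) ^+ 2)%:E + ((r * (- x 0 0 + 1 * z.1) ^+ 2)%:E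
     + ((r^-1 * (- y 0 0 + 1 * z.2) ^+ 2)%:E + (d ^+ 2)%:E))))%E.
  apply: ge0_le_integral => //.
  - by move=> z _; rewrite -EFinD lee_fin addr_ge0 // q0.
  - by apply: emeasurable_funD.
  - by do 2![apply: emeasurable_funD => //]; apply: emeasurable_funD.
  - by move=> z _; rewrite -!EFinD lee_fin ptw.
have ge0e (a b c : R) : 0 <= c -> forall z : R, (0 <= (c * (a + b * z) ^+ 2)%:E)%E.
  by move=> c0 z; rewrite lee_fin q0.
have rV : 0 <= r^-1 by rewrite invr_ge0 ltW.
rewrite ge0_integralD //; [|by move=> z _; apply: ge0e|by move=> z _; apply: ge0e].
rewrite m1 // m2 // ge0_integralD //; last 3 first.
- by move=> z _; rewrite lee_fin sqr_ge0.
- by move=> z _; rewrite -!EFinD lee_fin !addr_ge0 ?sqr_ge0 // q0 // ltW.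
- by apply: emeasurable_funD => //; apply: emeasurable_funD.
rewrite ge0_integralD //; last 3 first.
- by move=> z _; apply: ge0e; exact: ltW.
- by move=> z _; rewrite -!EFinD lee_fin !addr_ge0 ?sqr_ge0 // q0.
- exact: emeasurable_funD.
rewrite ge0_integralD //; [|by move=> z _; apply: ge0e|by move=> z _; rewrite lee_fin sqr_ge0].
have -> : (\int[g]_z (d ^+ 2)%:E = (d ^+ 2)%:E)%E.
  by rewrite integral_cst // [X in (_ * X)%E]probability_setT mule1.
rewrite m1 ?(ltW r0) // m2 //.
rewrite -!EFinD -leeBlDr //= -EFinB; apply: le_trans.
rewrite lee_fin /euclid_dist sqr_sqrtr ?addr_ge0 ?sqr_ge0 //.
(* For this [r] both weighted second moments equal the product of the scales, which leaves [d^2]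
   plus the square of the difference of the scales. *)
rewrite le_eqVlt; apply/orP; left; apply/eqP; rewrite /r /d; field.
by rewrite !gt_eqF.
Qed.

Lemma affine_coupling (x y : 'rV[R]_2) : half_plane x -> half_plane y ->
  exists2 g : probability (T * T)%type R,
    coupling (law (locscale phi x)) (law (locscale phi y)) g &
    (\int[g]_z ((z.1 - z.2) ^+ 2)%:E = (euclid_dist x y ^+ 2)%:E)%E.
Proof.
move=> hx hy; have mphi := profile_measurable hphi; have phi0 := profile_ge0 hphi.
pose P := law_prob mphi phi0 (sp_mass hphi).
pose f (t : T) : T * T := (x 0 0 + x 0 1 * t, y 0 0 + y 0 1 * t).
have mA (a b : R) : measurable_fun setT (fun t : T => a + b * t : T).
  by apply: measurable_funD => //; apply: measurable_funM.
have mf : measurable_fun setT f.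
  by apply: measurable_fun_pair; exact: mA.
pose F : {mfun T >-> (T * T)%type} := HB.pack f (isMeasurableFun.Build _ _ T (T * T)%type f mf).
have lawE (w : 'rV[R]_2) A : half_plane w -> measurable A ->
    P ((fun t => w 0 0 + w 0 1 * t) @^-1` A) = law (locscale phi w) A.
  move=> hw mA'; transitivity (\int[mu]_z ((\1_A z)%:E * (locscale phi w z)%:E))%E.
    rewrite (ge0_integral_locscale hphi hw); last 2 first.
    - by apply/measurable_EFinP.
    - by move=> z; rewrite lee_fin.
    rewrite [LHS]integral_mkcond; apply: eq_integral => t _.
    rewrite patchE -EFinM indicE; case: ifPn; rewrite ?inE ?notin_setE /= => tA.
      by rewrite (mem_set tA) mul1r.
    by rewrite (memNset tA) mul0r.
  rewrite [RHS]integral_mkcond; apply: eq_integral => t _.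
  by rewrite patchE -EFinM indicE; case: ifPn => tA; rewrite ?mul1r ?mul0r.
exists (distribution P F).
  move=> A mA'; rewrite -!lawE //; split; congr (P _); apply/seteqP;
    by split => t //= [].
transitivity (\int[P]_(t in f @^-1` setT) (((f t).1 - (f t).2) ^+ 2)%:E)%E.
  rewrite -(@ge0_integral_pushforward _ _ _ _ _ f mf P setT
    (fun z => ((z.1 - z.2) ^+ 2)%:E)) //.
  - by apply/measurable_EFinP; apply: measurable_funX; apply: measurable_funB.
  - by move=> z _; rewrite lee_fin sqr_ge0.
rewrite preimage_setT (ge0_integral_law mphi phi0 (sp_mass hphi)
  (h := fun t => (((f t).1 - (f t).2) ^+ 2)%:E)).
- rewrite /euclid_dist sqr_sqrtr ?addr_ge0 ?sqr_ge0 // -(profile_quad_moment hphi).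
  by apply: eq_integral => t _; rewrite -EFinM /=; congr EFin; congr (_ ^+ 2 * _); ring.
- by apply/measurable_EFinP; apply: measurable_funX; apply: measurable_funB; exact: mA.
- by move=> z; rewrite lee_fin sqr_ge0.
Qed.

Lemma W2_locscale (x y : 'rV[R]_2) : half_plane x -> half_plane y ->
  W2 (law (locscale phi x)) (law (locscale phi y)) = (euclid_dist x y)%:E.
Proof.
move=> hx hy; rewrite /W2.
rewrite (_ : ereal_inf _ = (euclid_dist x y ^+ 2)%:E).
  by rewrite /= sqrtr_sqr ger0_norm // sqrtr_ge0.
have [g cg gE] := affine_coupling hx hy.
apply/eqP; rewrite eq_le; apply/andP; split.
  by rewrite -gE; apply: ereal_inf_lbound; exists g.
apply: le_ereal_inf_tmp => _ [g' cg' <-]; exact: coupling_cost_ge.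
Qed.

Lemma ord2P (i : 'I_2) : i = 0 \/ i = 1.
Proof. by case: i => [[|[|//]] Hi]; [left|right]; exact: val_inj. Qed.

Lemma euclid_dist_eq0 (x y : 'rV[R]_2) : euclid_dist x y = 0 -> x = y.
Proof.
move=> /eqP; rewrite sqrtr_eq0 => xy.
have [h0 h1] : x 0 0 = y 0 0 /\ x 0 1 = y 0 1.
  by have := sqr_ge0 (x 0 0 - y 0 0); have := sqr_ge0 (x 0 1 - y 0 1); split; nra.
by apply/rowP => i; case: (ord2P i) => ->.
Qed.

(** Injectivity is read off the distance: parameters with equal densities are at Wasserstein
    distance zero, hence at Euclidean distance zero. *)
Lemma locscale_bij : set_bij (@half_plane R) (locscale_family phi) (locscale phi).
Proof.
split => //; first by move=> x hx; exists x.
move=> x y /set_mem hx /set_mem hy xy; apply: euclid_dist_eq0.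
have := W2_locscale hx hx; rewrite {2}xy (W2_locscale hx hy) => -[->].
by rewrite /euclid_dist !subrr expr0n addr0 sqrtr0.
Qed.

End wasserstein.

(** * The transport metric *)

Section transport.
Context {R : realType}.
Notation mu := (@lebesgue_measure R).
Variable phi : R -> R.
Hypothesis hphi : standard_profile phi.

Lemma locscale_integrable_bounded (x : 'rV[R]_2) (h : R -> R) (M : R) :
  half_plane x -> measurable_fun setT h -> (forall z, `|h z| <= M) ->
  mu.-integrable setT (EFin \o (fun z => h z * locscale phi x z)).
Proof.
move=> hx mh hM; have mp := locscale_measurable hphi x.
have p0 := locscale_ge0 hphi hx.
have ip : mu.-integrable setT (EFin \o locscale phi x).
  by apply: ge0_integrable => //; rewrite (locscale_mass hphi hx) ltry.
apply: (@le_integrable_fun _ _ (fun z => M * locscale phi x z)).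
- exact: measurable_funM.
- by move=> z; rewrite normrM (ger0_norm (p0 z)) ler_wpM2r.
- exact: (integrableZl measurableT M ip).
Qed.

Lemma profile_integrable_bounded (h : R -> R) (M : R) :
  measurable_fun setT h -> (forall z, `|h z| <= M) ->
  mu.-integrable setT (EFin \o (fun z => h z * phi z)).
Proof.
move=> mh hM; apply: (@le_integrable_fun _ _ (fun z => M * phi z)).
- by apply: measurable_funM => //; exact: profile_measurable.
- by move=> z; rewrite normrM (ger0_norm (profile_ge0 hphi z)) ler_wpM2r // profile_ge0.
- exact: (integrableZl measurableT M (profile_integrable hphi)).
Qed.

(** [ge0_integral_locscale] handles nonnegative integrands, so it is applied to [h + M]; the added
    constant contributes [M] on both sides, both densities having mass 1. *)
Lemma Rintegral_locscale (x : 'rV[R]_2) (h : R -> R) (M : R) :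
  half_plane x -> measurable_fun setT h -> (forall z, `|h z| <= M) ->
  \int[mu]_z (h z * locscale phi x z) = \int[mu]_y (h (x 0 0 + x 0 1 * y) * phi y).
Proof.
move=> hx mh hM; have mp := locscale_measurable hphi x.
have p0 := locscale_ge0 hphi hx.
have mT : measurable_fun setT (fun y : R => x 0 0 + x 0 1 * y).
  by apply: measurable_funD => //; apply: measurable_funM.
have mhT : measurable_fun setT (fun y => h (x 0 0 + x 0 1 * y)).
  exact: (measurableT_comp mh mT).
have hM0 z : 0 <= h z + M by have := hM z; rewrite ler_norml -subr_ge0 opprK => /andP[].
have E : \int[mu]_z ((h z + M) * locscale phi x z) =
    \int[mu]_y ((h (x 0 0 + x 0 1 * y) + M) * phi y).
  rewrite /Rintegral; congr fine.
  rewrite (_ : (\int[mu]_z _)%E = \int[mu]_z ((h z + M)%:E * (locscale phi x z)%:E))%E //.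
  rewrite (ge0_integral_locscale hphi hx) //.
  by apply/measurable_EFinP; apply: measurable_funD.
have i1 := locscale_integrable_bounded hx mh hM.
have i3 := profile_integrable_bounded mhT (fun z => hM _).
have M0 : `|M| = M by rewrite ger0_norm // (le_trans _ (hM 0)).
have cM (z : R) : `|cst M z| <= M by rewrite /cst M0.
have i2 := locscale_integrable_bounded hx (@measurable_cst _ _ _ _ setT M) cM.
have i4 := profile_integrable_bounded (@measurable_cst _ _ _ _ setT M) cM.
move: E; under eq_Rintegral do rewrite mulrDl.
under [in RHS]eq_Rintegral do rewrite mulrDl.
rewrite (RintegralD measurableT i1 i2) (RintegralD measurableT i3 i4) /cst.
have -> : \int[mu]_z (M * locscale phi x z) = M.
  rewrite RintegralZl //; last first.
    by apply: ge0_integrable => //; rewrite (locscale_mass hphi hx) ltry.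
  by rewrite /Rintegral (locscale_mass hphi hx) mulr1.
have -> : \int[mu]_z (M * phi z) = M.
  rewrite RintegralZl //; last exact: profile_integrable.
  by rewrite /Rintegral (sp_mass hphi) mulr1.
exact: addIr.
Qed.

Lemma continuous_compact_bounded (f : R -> R) (M : R) : continuous f ->
  (forall x, M < `|x| -> f x = 0) -> exists2 C : R, 0 < C & forall x, `|f x| <= C.
Proof.
move=> cf f0; have [C C0 fC] := continuous_itv_bounded (- M) M cf.
exists C => // x; have [xM|Mx] := leP `|x| M; last by rewrite f0 // normr0 ltW.
by move: xM; rewrite ler_norml => /andP[? ?]; exact: fC.
Qed.

Lemma test_function_derive1_out (f : R -> R) (M : R) :
  (forall x, M < `|x| -> f x = 0) -> forall x, M < `|x| -> derive1 f x = 0.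
Proof.
move=> f0 x Mx; rewrite derive1E.
have nE : \forall y \near x, f y = cst 0 y.
  have cn : (fun y : R => `|y|) y @[y --> x] --> `|x| by exact: norm_continuous.
  by apply: filterS (cvgr_gt _ cn _ Mx) => y My; rewrite f0.
by rewrite (near_eq_derive _ nE) derive_cst.
Qed.

(** * Velocity fields along a line of parameters *)

Section curve.
Variables (x xi : 'rV[R]_2).
Hypothesis hx : half_plane x.
Let q (t : R) := locscale phi (x + t *: xi).
(** The particle labelled [y] sits at [x 0 0 + x 0 1 * y] and moves with velocity
    [xi 0 0 + xi 0 1 * y]; [v0] expresses this velocity as a function of the position. *)
Let v0 (z : R) := xi 0 0 + xi 0 1 * ((z - x 0 0) / x 0 1).

Let q0E : q 0 = locscale phi x.
Proof. by rewrite /q scale0r addr0. Qed.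

Let s0 : 0 < x 0 1 := hx.

Let v0E z : v0 z = (xi 0 0 - xi 0 1 / x 0 1 * x 0 0) + (xi 0 1 / x 0 1) * z.
Proof. by rewrite /v0; field; rewrite gt_eqF. Qed.

Let cv0 : continuous v0.
Proof.
move=> z; apply: cvgD; first exact: cvg_cst.
apply: cvgM; first exact: cvg_cst.
by apply: cvgM; [apply: cvgB; [exact: cvg_id|exact: cvg_cst]|exact: cvg_cst].
Qed.

Let mv0 : measurable_fun setT v0.
Proof. exact: continuous_measurable_fun. Qed.

Let energy0 : (\int[mu]_z (v0 z ^+ 2 * q 0 z)%:E = (xi 0 0 ^+ 2 + xi 0 1 ^+ 2)%:E)%E.
Proof.
rewrite q0E; under eq_integral do rewrite v0E EFinM.
rewrite (locscale_quad_moment hphi hx); congr EFin; congr (_ ^+ 2 + _ ^+ 2); last first.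
  by field; rewrite gt_eqF.
by rewrite subrK.
Qed.

(** After the change of variables the time [t] occurs only inside [f], and the integral can be
    differentiated under its sign without any derivative of [phi]. *)
Let derive_integral f : test_function f ->
  is_derive (0 : R) (1 : R) (fun t : R => \int[mu]_z (f z * q t z))
    (\int[mu]_z (derive1 f z * v0 z * q 0 z)).
Proof.
move=> [df cf' [M fM]].
have Df (z : R) : is_derive z (1 : R) f (derive1 f z).
  by apply: DeriveDef; [exact: df|rewrite derive1E].
have cf := is_derive_continuous Df.
have f'M := test_function_derive1_out fM.
have [C C0 fC] := continuous_compact_bounded cf fM.
have [C' C'0 f'C] := continuous_compact_bounded cf' f'M.
pose w (y : R) := xi 0 0 + xi 0 1 * y.
pose F (t y : R) := f (x 0 0 + x 0 1 * y + t * w y) * phi y.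
have DF (t y : R) : is_derive t (1 : R) (F ^~ y)
    (derive1 f (x 0 0 + x 0 1 * y + t * w y) * w y * phi y).
  have Du : is_derive t (1 : R) (fun t => x 0 0 + x 0 1 * y + t * w y) (w y).
    by apply: is_derive_eq; rewrite /GRing.scale /=; ring.
  have D1 := @is_derive1_comp _ f (fun t => x 0 0 + x 0 1 * y + t * w y) t _ _
    (Df (x 0 0 + x 0 1 * y + t * w y)) Du.
  have D2 := is_deriveM D1 (is_derive_cst (phi y) t 1).
  by apply: (is_derive_eq D2); rewrite /GRing.scale /cst /=; ring.
have mphi := profile_measurable hphi.
have p0 := profile_ge0 hphi.
have mw (t : R) : measurable_fun setT (fun y : R => x 0 0 + x 0 1 * y + t * w y).
  apply: measurable_funD; first by apply: measurable_funD => //; apply: measurable_funM.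
  by apply: measurable_funM => //; apply: measurable_funD => //; apply: measurable_funM.
have iF (t : R) : mu.-integrable setT (EFin \o F t).
  apply: profile_integrable_bounded (fun y => fC _).
  by apply: (measurableT_comp _ (mw t)); exact: continuous_measurable_fun.
(* A bound of the [t]-derivative for all [t], integrable because [phi] has a finite first absolute
   moment. *)
pose G (y : R) := C' * (`|xi 0 0| * phi y + `|xi 0 1| * (`|y| * phi y)).
have G0 y : 0 <= G y.
  by apply: mulr_ge0; [exact: ltW|apply: addr_ge0; rewrite !mulr_ge0].
have iG : mu.-integrable setT (EFin \o G).
  have i1 : mu.-integrable setT (EFin \o (fun y => `|y| * phi y)).
    rewrite (_ : EFin \o _ = (fun y => `|(y * phi y)%:E|%E)).
      exact: (integrable_abse (profile_integrable1 hphi)).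
    by apply/funext => y /=; rewrite normrM (ger0_norm (profile_ge0 hphi y)).
  have := integrableZl measurableT C' (integrableD measurableT
    (integrableZl measurableT `|xi 0 0| (profile_integrable hphi))
    (integrableZl measurableT `|xi 0 1| i1)).
  by [].
have GF (t y : R) : `|partial1of2 F t y| <= G y.
  have [_ pE] := DF t y; rewrite partial1of2E pE /G.
  rewrite 2!normrM (ger0_norm (profile_ge0 hphi y)).
  rewrite -mulrA; apply: ler_pM => //; first by rewrite mulr_ge0.
  rewrite [X in _ + X]mulrA -mulrDl ler_wpM2r // /w.
  by rewrite (le_trans (ler_normD _ _)) // normrM.
pose I : set R := `](-1), 1[%classic.
have I0 : I 0 by rewrite /I /= in_itv /= ltr01 andbT oppr_lt0.
have dF (t y : R) : derivable (F ^~ y) t 1 by have [] := DF t y.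
have H1 := @derivable_under_integral R _ _ mu F setT measurableT 0 (-1) 1 I0
  (fun t _ => iF t) (fun t y _ _ => dF t y) G G0 iG (fun t y _ _ => GF t y).
have H2 := @differentiation_under_integral R _ _ mu F setT measurableT 0 (-1) 1 I0
  (fun t _ => iF t) (fun t y _ _ => dF t y) G G0 iG (fun t y _ _ => GF t y).
have H : is_derive (0 : R) (1 : R) (fun t : R => \int[mu]_y F t y)
    (\int[mu]_z (derive1 f z * v0 z * q 0 z)).
  apply: DeriveDef; first exact: H1.
  rewrite -derive1E H2 q0E.
  have [B B0 hB] : exists2 B : R, 0 < B & forall z, `|derive1 f z * v0 z| <= B.
    apply: (@continuous_compact_bounded _ M) => [z|z Mz]; last by rewrite f'M // mul0r.
    by apply: cvgM; [exact: cf'|exact: cv0].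
  rewrite (Rintegral_locscale hx _ hB).
    apply: eq_Rintegral => y _; have [_ pE] := DF 0 y.
    rewrite partial1of2E pE mul0r addr0; congr (_ * _ * _).
    by rewrite /w /v0; field; rewrite gt_eqF.
  by apply: measurable_funM => //; exact: continuous_measurable_fun.
(* The pulled-back integral is the integral against [q t] only while the scale [x 0 1 + t * xi 0 1]
   is positive, hence for [t] near 0. *)
apply: near_eq_is_derive H.
have nt : \forall t \near (0 : R), 0 < x 0 1 + t * xi 0 1.
  have ct : (fun t : R => x 0 1 + t * xi 0 1) t @[t --> (0 : R)] --> x 0 1 + 0 * xi 0 1.
    by apply: cvgD; [exact: cvg_cst|apply: cvgM; [exact: cvg_id|exact: cvg_cst]].
  by apply: (cvgr_gt _ ct); rewrite mul0r addr0.
apply: filterS nt => t st.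
have ht : half_plane (x + t *: xi) by rewrite /half_plane /= !mxE.
rewrite /q (Rintegral_locscale ht _ fC); last exact: continuous_measurable_fun.
by apply: eq_Rintegral => y _; rewrite /F !mxE /w; congr (f _ * _); ring.
Qed.


Let p0 z : 0 <= q 0 z.
Proof. by rewrite q0E; exact: locscale_ge0. Qed.

Let mq0 : measurable_fun setT (q 0).
Proof. by rewrite q0E; exact: locscale_measurable. Qed.

(* [psi] is a potential of [v0], so that [(psi * cutoff n)'] approximates [v0] in [L^2 (q 0)]. *)
Let a := xi 0 0 - xi 0 1 / x 0 1 * x 0 0.
Let b := xi 0 1 / x 0 1.
Let psi (z : R) := a * z + b / 2 * z ^+ 2.
Let dpsi n z := v0 z * cutoff n z + psi z * dcutoff n z.

Let derive_psi n (z : R) : is_derive z (1 : R) (fun z => psi z * cutoff n z) (dpsi n z).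
Proof.
have d : is_derive z (1 : R) psi (v0 z).
  by apply: is_derive_eq; rewrite /GRing.scale /= v0E /a /b; field; rewrite gt_eqF.
have := is_deriveM d (is_derive_cutoff n z) => H.
by apply: (is_derive_eq H); rewrite /dpsi /GRing.scale /=; ring.
Qed.

Let continuous_dpsi n : continuous (dpsi n).
Proof.
move=> z; apply: cvgD; apply: cvgM.
- exact: cv0.
- exact: (is_derive_continuous (is_derive_cutoff n)).
- apply: cvgD; apply: cvgM; [exact: cvg_cst|exact: cvg_id|exact: cvg_cst|exact: exprn_continuous].
- exact: continuous_dcutoff.
Qed.

Let test_psi n : test_function (fun z => psi z * cutoff n z).
Proof.
split.
- by move=> z; have [] := derive_psi n z.
- rewrite (_ : derive1 _ = dpsi n) //.
  by apply/funext => z; rewrite derive1E; have [_ ->] := derive_psi n z.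
- exists n.+1%:R => z nz; rewrite /cutoff cutoff_root_out ?expr0n ?mulr0 //.
  exact: ltW.
Qed.

Let cvg_dpsi : (\int[mu]_z ((v0 z - dpsi n z) ^+ 2 * q 0 z)%:E @[n --> \oo] --> 0)%E.
Proof.
(* The error is at most [5 (|a| + |b| |z|)]: 1 from [v0 (1 - cutoff n)] and 4 from [psi] times
   [dcutoff n]. Squaring, with [(A + B)^2 <= 2 (A^2 + B^2)], gives 50. *)
pose D z := 50 * (a ^+ 2 + b ^+ 2 * z ^+ 2) * q 0 z.
have bound n z : `|v0 z - dpsi n z| <= 5 * `|a| + 5 * `|b| * `|z|.
  have v0b : `|v0 z| <= `|a| + `|b| * `|z|.
    by rewrite v0E -/a -/b -normrM ler_normD.
  have -> : v0 z - dpsi n z = v0 z * (1 - cutoff n z) - psi z * dcutoff n z.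
    by rewrite /dpsi; ring.
  apply: le_trans (ler_normB _ _) _.
  have e1 : `|v0 z * (1 - cutoff n z)| <= `|a| + `|b| * `|z|.
    rewrite normrM; apply: le_trans v0b; rewrite ler_piMr //.
    by rewrite ger0_norm ?subr_ge0 ?cutoff_le1 // gerBl cutoff_ge0.
  have e2 : `|z| * `|dcutoff n z| <= 4.
    have [nz|zn] := leP n.+1%:R `|z|; first by rewrite dcutoff_out // normr0 mulr0.
    apply: (@le_trans _ _ (n.+1%:R * (4 / n.+1%:R))).
      by apply: ler_pM; rewrite ?dcutoff_bound //; exact: ltW.
    by rewrite mulrCA divff // mulr1.
  have e3 : `|psi z| <= `|z| * (`|a| + `|b| * `|z|).
    rewrite /psi (_ : _ + _ = z * (a + b / 2 * z)); last by ring.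
    rewrite normrM ler_wpM2l // (le_trans (ler_normD _ _)) // lerD2l !normrM.
    rewrite ler_wpM2r // ler_piMr // ger0_norm ?invr_ge0 // invf_le1 ?ler1n //.
  have e4 : `|psi z * dcutoff n z| <= 4 * (`|a| + `|b| * `|z|).
    rewrite normrM; apply: (@le_trans _ _ ((`|z| * (`|a| + `|b| * `|z|)) * `|dcutoff n z|)).
      by rewrite ler_wpM2r.
    by rewrite mulrAC ler_wpM2r // addr_ge0 // mulr_ge0.
  lra.
have GD n z : `|(v0 z - dpsi n z) ^+ 2 * q 0 z| <= D z.
  rewrite normrM (ger0_norm (p0 z)) ler_wpM2r // ger0_norm ?sqr_ge0 //.
  rewrite -(real_normK (num_real (v0 z - _))) -(real_normK (num_real a)).
  rewrite -(real_normK (num_real b)) -(real_normK (num_real z)) -exprMn.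
  have := bound n z; have := normr_ge0 (v0 z - dpsi n z).
  have := normr_ge0 a; have : 0 <= `|b| * `|z| by rewrite mulr_ge0.
  rewrite -mulrA; set B := `|b| * `|z|; set A := `|a|; set V := `|v0 z - _|.
  move=> B0 A0 V0 VAB.
  have : V ^+ 2 <= (5 * A + 5 * B) ^+ 2 by rewrite ler_sqr ?nnegrE // addr_ge0 // mulr_ge0.
  have := sqr_ge0 (A - B); nra.
have i2 : mu.-integrable setT (EFin \o (fun z => z ^+ 2 * q 0 z)).
  apply: ge0_integrable.
  - by apply: measurable_funM => //; exact: measurable_funX.
  - by move=> z; rewrite mulr_ge0 ?sqr_ge0.
  - have := locscale_quad_moment hphi hx 0 1; rewrite -q0E.
    under eq_integral do rewrite add0r mul1r -EFinM.
    by move=> ->; rewrite ltry.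
have i0 : mu.-integrable setT (EFin \o q 0).
  by apply: ge0_integrable => //; rewrite q0E (locscale_mass hphi hx) ltry.
have iD : mu.-integrable setT (EFin \o D).
  have := integrableD measurableT (integrableZl measurableT (50 * a ^+ 2) i0)
    (integrableZl measurableT (50 * b ^+ 2) i2).
  congr (_.-integrable _ _).
  by apply/funext => z /=; rewrite -!EFinM -EFinD /D; congr EFin; ring.
rewrite [X in _ --> X](_ : _ = \int[mu]_z (0 : R)%:E)%E; last by rewrite integral0.
apply: (@dominated_cvg _ _ _ mu setT measurableT
  (fun n z => ((v0 z - dpsi n z) ^+ 2 * q 0 z)%:E) _ (EFin \o D)) => //.
- move=> n; apply/measurable_EFinP; apply: measurable_funM => //; apply: measurable_funX.
  by apply: measurable_funB => //; exact: continuous_measurable_fun.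
- move=> z _; apply: cvg_EFin; first exact: nearW.
  pose l := v0 z - (v0 z * 1 + psi z * 0).
  have c : v0 z - dpsi n z @[n --> \oo] --> l.
    apply: cvgB; first exact: cvg_cst.
    apply: cvgD; apply: cvgM; try exact: cvg_cst.
      exact: cvg_cutoff.
    exact: cvg_dcutoff.
  have : (v0 z - dpsi n z) * (v0 z - dpsi n z) * q 0 z @[n --> \oo] --> l * l * q 0 z.
    by apply: cvgM; [exact: cvgM|exact: cvg_cst].
  have -> : l * l * q 0 z = 0 by rewrite /l; ring.
  by apply: cvg_trans; apply: near_eq_cvg; apply: nearW => n; rewrite /= expr2.
- by move=> n z _; rewrite /= lee_fin.
Qed.

(** Integrate [2 v f' <= v^2 + f'^2] for [f' = dpsi n]. The weak continuity equation, satisfied by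
    both fields, replaces [v] by [v0] in the product, and [2 v0 f' - f'^2 = v0^2 - (v0 - f')^2]
    leaves the approximation error on the right. *)
Let energy_ge v n : velocity_field q v ->
  ((xi 0 0 ^+ 2 + xi 0 1 ^+ 2)%:E <= \int[mu]_z (v z ^+ 2 * q 0 z)%:E
     + \int[mu]_z ((v0 z - dpsi n z) ^+ 2 * q 0 z)%:E)%E.
Proof.
move=> [mv vfin vf].
have [_ E1] := vf _ (test_psi n); have [_ E2] := derive_integral (test_psi n).
move: E1; rewrite E2; have -> : derive1 (fun z => psi z * cutoff n z) = dpsi n.
  by apply/funext => z; rewrite derive1E; have [_ ->] := derive_psi n z.
move=> E.
have md : measurable_fun setT (dpsi n) by exact: continuous_measurable_fun.
have [C C0 dC] : exists2 C : R, 0 < C & forall z, `|dpsi n z| <= C.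
  apply: (@continuous_compact_bounded _ n.+1%:R) => // z nz.
  by rewrite /dpsi /cutoff cutoff_root_out ?dcutoff_out ?expr0n ?mulr0 ?addr0 // ltW.
have isq (w : R -> R) : measurable_fun setT w ->
    (\int[mu]_z (w z ^+ 2 * q 0 z)%:E < +oo)%E ->
    mu.-integrable setT (EFin \o (fun z => w z ^+ 2 * q 0 z)).
  move=> mw; apply: ge0_integrable.
    by apply: measurable_funM => //; exact: measurable_funX.
  by move=> z; rewrite mulr_ge0 ?sqr_ge0.
have iv := isq _ mv vfin.
have iv0 : mu.-integrable setT (EFin \o (fun z => v0 z ^+ 2 * q 0 z)).
  by apply: isq => //; rewrite energy0 ltry.
have id : mu.-integrable setT (EFin \o (fun z => dpsi n z ^+ 2 * q 0 z)).
  rewrite q0E; apply: (@locscale_integrable_bounded _ _ (C ^+ 2)) => //.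
    exact: measurable_funX.
  by move=> z; rewrite normrX ler_sqr ?nnegrE // ltW.
have iprod (w : R -> R) : measurable_fun setT w ->
    mu.-integrable setT (EFin \o (fun z => w z ^+ 2 * q 0 z)) ->
    mu.-integrable setT (EFin \o (fun z => dpsi n z * w z * q 0 z)).
  move=> mw iw.
  apply: (@le_integrable_fun _ _ (fun z => dpsi n z ^+ 2 * q 0 z + w z ^+ 2 * q 0 z)).
  - by apply: measurable_funM => //; exact: measurable_funM.
  - move=> z; rewrite normrM (ger0_norm (p0 z)) -mulrDl ler_wpM2r // normrM.
    rewrite -(real_normK (num_real (w z))) -(real_normK (num_real (dpsi n z))).
    have := sqr_ge0 (`|dpsi n z| - `|w z|); have := normr_ge0 (dpsi n z); have := normr_ge0 (w z).
    nra.
  - exact: (integrableD measurableT id iw).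
have ivd := iprod _ mv iv; have iv0d := iprod _ mv0 iv0.
have EE (w : R -> R) : mu.-integrable setT (EFin \o w) ->
    (\int[mu]_z (w z)%:E)%E = (\int[mu]_z w z)%:E.
  by move=> iw; rewrite /Rintegral fineK //; exact: integrable_fin_num.
have eqf : (fun z => (v0 z - dpsi n z) ^+ 2 * q 0 z) = (fun z => v0 z ^+ 2 * q 0 z
    + (- 2 * (dpsi n z * v0 z * q 0 z) + dpsi n z ^+ 2 * q 0 z)).
  by apply/funext => z; ring.
have i2 : mu.-integrable setT (EFin \o (fun z => - 2 * (dpsi n z * v0 z * q 0 z))).
  exact: (integrableZl measurableT (- 2) iv0d).
have i3 : mu.-integrable setT
    (EFin \o (fun z => - 2 * (dpsi n z * v0 z * q 0 z) + dpsi n z ^+ 2 * q 0 z)).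
  exact: (integrableD measurableT i2 id).
have i4 : mu.-integrable setT (EFin \o (fun z => 2 * (dpsi n z * v z * q 0 z))).
  exact: (integrableZl measurableT 2 ivd).
have ie : mu.-integrable setT (EFin \o (fun z => (v0 z - dpsi n z) ^+ 2 * q 0 z)).
  by rewrite eqf; exact: (integrableD measurableT iv0 i3).
rewrite (EE _ iv) (EE _ ie) -energy0 (EE _ iv0) -EFinD lee_fin eqf.
rewrite (RintegralD measurableT iv0 i3) (RintegralD measurableT i2 id).
rewrite (RintegralZl _ measurableT iv0d) addrCA lerDl mulNr addrCA addrC subr_ge0.
rewrite E -(RintegralZl _ measurableT ivd) -(RintegralD measurableT iv id).
apply: le_Rintegral => //; first exact: (integrableD measurableT iv id).
move=> z _; rewrite -mulrDl mulrA ler_wpM2r //.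
by have := sqr_ge0 (v z - dpsi n z); rewrite sqrrB; lra.
Qed.

Lemma transport_sqnorm_locscale :
  transport_sqnorm q = (xi 0 0 ^+ 2 + xi 0 1 ^+ 2)%:E.
Proof.
apply/eqP; rewrite eq_le; apply/andP; split.
  rewrite -energy0; apply: ereal_inf_lbound; exists v0 => //; split => //.
    by rewrite energy0 ltry.
apply: le_ereal_inf_tmp => _ [v vv <-].
have /fine_cvgP[fin cv] := cvg_dpsi.
apply/lee_addgt0Pr => e e0; near \oo => n.
apply: le_trans (energy_ge n vv) _; rewrite leeD2l //.
have /fineK <- : (\int[mu]_z ((v0 z - dpsi n z) ^+ 2 * q 0 z)%:E)%E \is a fin_num.
  by near: n; exact: fin.
rewrite lee_fin; apply: ltW; near: n.
exact: (cvgr_lt _ cv).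
Unshelve. all: by end_near. Qed.

End curve.

Lemma transport_metric_locscale (x : 'rV[R]_2) : half_plane x ->
  transport_metric (locscale phi) x = 1%:M.
Proof.
move=> hx; apply/matrixP => i j; rewrite /transport_metric !mxE.
rewrite !(transport_sqnorm_locscale _ hx) /= !mxE /=.
by case: (ord2P i) => ->; case: (ord2P j) => ->; rewrite /= ; field.
Qed.

End transport.

(** * Curvature of a conformal metric on the half-plane *)

Section curvature.
Context {R : realType}.
Implicit Types (x y v : 'rV[R]_2) (i j k l : 'I_2).

(** The closed forms of the metric and of its Christoffel symbols hold on the half-plane only; its
    openness permits differentiating them. *)
Lemma near_half_plane x : half_plane x -> \forall y \near x, half_plane y.
Proof.
move=> hx; have cc : (fun y : 'rV[R]_2 => y 0 1) y @[y --> x] --> x 0 1.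
  exact: coord_continuous.
exact: (cvgr_gt _ cc).
Qed.

(** Along the line [t *: v + x] the function is [h] composed with an affine function of [t]. Every
    derivative of the metric thus becomes a one-variable derivative. *)
Lemma is_derive_coord1 (h : R -> R) (h' : R) x v :
  is_derive (x 0 1) (1 : R) h h' ->
  is_derive x v (fun y : 'rV[R]_2 => h (y 0 1)) (v 0 1 * h').
Proof.
move=> dh; pose f (y : 'rV[R]_2) := h (y 0 1).
have Du : is_derive (0 : R) (1 : R) (fun t : R => t * v 0 1 + x 0 1) (v 0 1).
  by apply: is_derive_eq; rewrite /GRing.scale /=; ring.
have Dh : is_derive ((fun t : R => t * v 0 1 + x 0 1) 0) (1 : R) h h'.
  by rewrite /= mul0r add0r.
have D := @is_derive1_comp _ h (fun t : R => t * v 0 1 + x 0 1) 0 _ _ Dh Du.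
have fE : (fun t : R => f (t *: v + x)) = h \o (fun t : R => t * v 0 1 + x 0 1).
  by apply/funext => t; rewrite /f !mxE.
rewrite -fE in D; apply: DeriveDef.
  by apply/derivable1P; case: D.
rewrite [RHS]mulrC; have [_ <-] := D.
rewrite /derive; set F := (X in lim (X @ _)); set G := (X in _ = lim (X @ _)).
suff -> : F = G by []; apply/funext => t; rewrite /F /G /=.
by rewrite addr0 [t%:A]mulr1 scale0r add0r.
Qed.

Variables (g : 'rV[R]_2 -> 'M[R]_2) (c : R).
Hypothesis c0 : 0 < c.
Hypothesis gE : forall y, half_plane y -> g y = (c / y 0 1 ^+ 2)%:M.

Let derive_inv_coord1 (a : R) n x i : half_plane x ->
  'D_(basis_vec R i) (fun y : 'rV[R]_2 => a / y 0 1 ^+ n.+1) x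
   = (i == 1)%:R * (- n.+1%:R * a / x 0 1 ^+ n.+2).
Proof.
move=> hx; have x0 : x 0 1 != 0 by rewrite gt_eqF.
have D : is_derive (x 0 1) (1 : R) (fun s : R => a / s ^+ n.+1) (- n.+1%:R * a / x 0 1 ^+ n.+2).
  have D1 : is_derive (x 0 1) (1 : R) (fun s : R => s ^+ n.+1) (n.+1%:R * x 0 1 ^+ n).
    apply: DeriveDef; first exact: exprn_derivable.
    by rewrite exp_derive scaler1.
  have xn : x 0 1 ^+ n.+1 != 0 by rewrite expf_neq0.
  have D2 := is_deriveM (is_derive_cst a (x 0 1) 1) 
    (@is_deriveV _ (fun s : R => s ^+ n.+1) (x 0 1) _ 1 xn D1).
  apply: (is_derive_eq D2); rewrite /GRing.scale /cst /=.
  have zn : x 0 1 ^+ n != 0 by rewrite expf_neq0.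
  rewrite !exprS; move: (x 0 1 ^+ n) zn => z zn.
  by field; rewrite zn x0.
by have [_ ->] := is_derive_coord1 (basis_vec R i) D; rewrite mxE eqxx eq_sym.
Qed.

Let derive_metric x i j l : half_plane x ->
  'D_(basis_vec R i) (fun y => g y j l) x
   = (i == 1)%:R * (j == l)%:R * (- 2 * c / x 0 1 ^+ 3).
Proof.
move=> hx; have nE : \forall y \near x, g y j l = (j == l)%:R * c / y 0 1 ^+ 2.
  by apply: filterS (near_half_plane hx) => y hy; rewrite gE // mxE -[LHS]mulr_natl mulrA.
rewrite (near_eq_derive _ nE) derive_inv_coord1 //; ring.
Qed.

(** For a conformal factor [exp (2 u)] the Christoffel symbols are the combination of deltas below
    with the partial derivatives of [u] as coefficients; here only the derivative in [s] survives
    and equals [- 1 / s]. *)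
Let C k i j : R := (i == 1)%:R * (j == k)%:R + (j == 1)%:R * (i == k)%:R
  - (k == 1)%:R * (i == j)%:R.

(** The exponent 1 is kept so that [derive_inv_coord1] applies with [n = 0]. *)
Let christoffelE x k i j : half_plane x -> christoffel g k i j x = - C k i j / x 0 1 ^+ 1.
Proof.
move=> hx; have x0 : x 0 1 != 0 by rewrite gt_eqF.
rewrite /christoffel gE // invmx_scalar (bigD1 k) //= big1 ?addr0; last first.
  by move=> l lk; rewrite mxE eq_sym (negbTE lk) mulr0n mul0r.
rewrite mxE eqxx mulr1n !derive_metric // /C; field.
by rewrite x0 gt_eqF.
Qed.

Let derive_christoffel x m k i j : half_plane x ->
  'D_(basis_vec R m) (christoffel g k i j) x = (m == 1)%:R * (C k i j / x 0 1 ^+ 2).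
Proof.
move=> hx.
have nE : \forall y \near x, christoffel g k i j y = - C k i j / y 0 1 ^+ 1.
  by apply: filterS (near_half_plane hx) => y hy; rewrite christoffelE.
rewrite (near_eq_derive _ nE) derive_inv_coord1 //; ring.
Qed.

(** The only curvature component involved is [- 1 / s^2], free of [c]; multiplying by [c / s^2] and
    dividing by the determinant [c^2 / s^4] leaves [- 1 / c]. *)
Lemma gauss_curvature_hyperbolic x : half_plane x -> gauss_curvature g x = - (1 / c).
Proof.
move=> hx; have x0 : x 0 1 != 0 by rewrite gt_eqF.
rewrite /gauss_curvature gE // det_scalar.
rewrite (bigD1 0) //= big1 ?addr0; last first.
  by move=> l l0; rewrite mxE eq_sym (negbTE l0) mulr0n mul0r.
rewrite mxE eqxx mulr1n /riemann !derive_christoffel // big_ord_recl big_ord1.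
rewrite !christoffelE // /C /=; field.
by rewrite x0 gt_eqF.
Qed.

End curvature.

(** * Fisher information *)

Section fisher_information.
Context {R : realType}.
Notation mu := (@lebesgue_measure R).

Lemma integrableD_fun (f g : R -> R) : mu.-integrable setT (EFin \o f) ->
  mu.-integrable setT (EFin \o g) -> mu.-integrable setT (EFin \o (fun x => f x + g x)).
Proof. by move=> fi gi; exact: (integrableD measurableT fi gi). Qed.

Lemma integrableZ_fun (c : R) (f : R -> R) : mu.-integrable setT (EFin \o f) ->
  mu.-integrable setT (EFin \o (fun x => c * f x)).
Proof. by move=> fi; exact: (integrableZl measurableT c fi). Qed.

Lemma integralD_fun (f g : R -> R) : mu.-integrable setT (EFin \o f) ->
  mu.-integrable setT (EFin \o g) ->
  (\int[mu]_x (f x + g x)%:E = \int[mu]_x (f x)%:E + \int[mu]_x (g x)%:E)%E.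
Proof. by move=> fi gi; exact: (integralD measurableT fi gi). Qed.

Lemma integralZ_fun (c : R) (f : R -> R) : mu.-integrable setT (EFin \o f) ->
  (\int[mu]_x (c * f x)%:E = c%:E * \int[mu]_x (f x)%:E)%E.
Proof. by move=> fi; exact: (integralZl measurableT fi c). Qed.

Lemma normr_id_le (x : R) : `|x| <= 1 + `|x|. Proof. by rewrite lerDr. Qed.

Lemma integral_id_derive1 (p : R -> R) : abs_cont p ->
  mu.-integrable setT (EFin \o p) ->
  mu.-integrable setT (EFin \o (fun x => x * derive1 p x)) ->
  (\int[mu]_x (x * derive1 p x + 1 * p x)%:E = 0)%E.
Proof.
move=> acp ip ixp; apply: (@integration_by_parts_line _ p id (cst 1) 1) => //.
- by move=> x; exact: cst_continuous.
- exact: normr_id_le.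
- by move=> x; rewrite /cst normr1.
Qed.

Lemma integral_derive1 (p : R -> R) : abs_cont p ->
  mu.-integrable setT (EFin \o p) ->
  mu.-integrable setT (EFin \o derive1 p) -> (\int[mu]_x (derive1 p x)%:E = 0)%E.
Proof.
move=> acp ip idp.
rewrite -(@integration_by_parts_line _ p (cst 1) (cst 0) 0) //.
- by apply: eq_integral => x _; rewrite /cst mul1r mul0r addr0.
- by move=> x; exact: cst_continuous.
- by move=> x; rewrite /cst normr1 lerDl.
- by move=> x; rewrite /cst normr0.
- by rewrite (_ : (fun x => _) = derive1 p) //; apply/funext => x; rewrite /cst mul1r.
Qed.

Lemma normal_pdf_neq0E (m s x : R) : s != 0 ->
  normal_pdf m s x = normal_peak s * expR (- (x - m) ^+ 2 / (s ^+ 2 *+ 2)).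
Proof. by move=> s0; rewrite /normal_pdf (negbTE s0). Qed.

Lemma is_derive_normal_pdf (m s x : R) : s != 0 ->
  is_derive x (1 : R) (normal_pdf m s) (- ((x - m) / s ^+ 2) * normal_pdf m s x).
Proof.
move=> s0; rewrite (_ : normal_pdf m s =
    fun x => normal_peak s * expR (- (x - m) ^+ 2 / (s ^+ 2 *+ 2))); last first.
  by apply/funext => y; rewrite normal_pdf_neq0E.
pose e := fun x : R => - (x - m) ^+ 2 / (s ^+ 2 *+ 2).
have D : is_derive x (1 : R) e (- ((x - m) / s ^+ 2)).
  by rewrite /e; apply: is_derive_eq; rewrite /GRing.scale /=; field.
have D1 := @is_derive1_comp _ expR e x _ _ (is_derive_expR (e x)) D.
have D2 := is_deriveM (is_derive_cst (normal_peak s) x 1) D1.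
by apply: (is_derive_eq D2); rewrite /GRing.scale /cst /= /e; ring.
Qed.

Section profile.
Variable phi : R -> R.
Hypothesis hphi : standard_profile phi.

Let phi_gt0 := sp_gt0 hphi.
Let dphi := derive1 phi.
Let mphi : measurable_fun setT phi := profile_measurable hphi.

Let mdphi : measurable_fun setT dphi.
Proof. by apply: measurable_derive1; apply: abs_cont_continuous; exact: sp_abs_cont. Qed.

Let mfish : measurable_fun setT (fun x => dphi x ^+ 2 / phi x).
Proof.
apply: measurable_funM; first exact: measurable_funX.
apply: continuous_measurable_fun => x; apply: cvgV; first by rewrite gt_eqF.
by apply: abs_cont_continuous; exact: sp_abs_cont.
Qed.

Let fish_ge0 x : 0 <= dphi x ^+ 2 / phi x.
Proof. by rewrite divr_ge0 ?sqr_ge0 // ltW. Qed.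

Lemma fisher_fin_num : fisher phi \is a fin_num.
Proof.
rewrite ge0_fin_numE; last by apply: integral_ge0 => x _; rewrite lee_fin.
exact: sp_fisher.
Qed.

Let ifish : mu.-integrable setT (EFin \o (fun x => dphi x ^+ 2 / phi x)).
Proof. by apply: ge0_integrable => //; exact: sp_fisher. Qed.

(** By AM-GM [2 |x phi'|] is at most [x^2 phi + phi'^2 / phi], whose integral is the variance plus
    the Fisher information. *)
Let ixdphi : mu.-integrable setT (EFin \o (fun x => x * dphi x)).
Proof.
apply: (@le_integrable_fun _ _ (fun x => x ^+ 2 * phi x + dphi x ^+ 2 / phi x)).
- exact: measurable_funM.
- move=> x; have px := phi_gt0 x.
  rewrite (_ : _ + _ = (`|x| * phi x - `|dphi x|) ^+ 2 / phi x + 2 * `|x * dphi x|); last first.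
    rewrite normrM -[in LHS](real_normK (num_real x)) -[in LHS](real_normK (num_real (dphi x))).
    by field; rewrite gt_eqF.
  rewrite mulr_natl mulr2n addrA lerDr addr_ge0 // divr_ge0 ?sqr_ge0 // ltW //.
- by apply: integrableD_fun => //; exact: profile_integrable2.
Qed.

Lemma score_deficit :
  (\int[mu]_x ((dphi x / phi x + x) ^+ 2 * phi x)%:E = fisher phi - 1)%E.
Proof.
have ip := profile_integrable hphi.
have ix2 := profile_integrable2 hphi.
have i1 := integrableD_fun ixdphi (integrableZ_fun 1 ip).
have i2 := integrableZ_fun 2 i1.
have i3 := integrableZ_fun (- 2) ip.
(* The cross term [2 x phi'] is completed by [2 phi] so as to integrate to zero by parts; the
   compensating [- 2 phi] and the variance then add up to -1. *)
transitivity (\int[mu]_x (dphi x ^+ 2 / phi x + (2 * (x * dphi x + 1 * phi x)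
    + (x ^+ 2 * phi x + - 2 * phi x)))%:E)%E.
  by apply: eq_integral => x _; congr EFin; field; rewrite gt_eqF.
rewrite integralD_fun //; last by apply: integrableD_fun => //; exact: integrableD_fun.
rewrite integralD_fun //; last exact: integrableD_fun.
rewrite integralD_fun // !integralZ_fun //.
rewrite (integral_id_derive1 (sp_abs_cont hphi) ip ixdphi) (sp_var hphi) (sp_mass hphi).
rewrite mule0 mule1 add0e; congr (_ + _)%E; rewrite -EFinD; congr EFin; lra.
Qed.

Lemma fisher_ge1 : 1 <= fine (fisher phi).
Proof.
rewrite -lee_fin fineK ?fisher_fin_num // -sube_ge0 ?fisher_fin_num // -score_deficit.
by apply: integral_ge0 => x _; rewrite lee_fin mulr_ge0 ?sqr_ge0 // ltW.
Qed.

Lemma fisher_eq1_gaussian : fine (fisher phi) = 1 -> is_gaussian phi.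
Proof.
move=> J1; have fJ1 : fisher phi = 1%E by rewrite -(fineK fisher_fin_num) J1.
have aef : Filter (nbhs (almost_everywhere mu)) := ae_filter_ringOfSetsType mu.
have acphi := sp_abs_cont hphi.
have dphiE : {ae mu, forall x, dphi x = - x * phi x}.
  have : ae_eq mu setT (fun x => ((dphi x / phi x + x) ^+ 2 * phi x)%:E) (cst 0%E).
    apply/ae_eq_integral_abs => //.
      apply/measurable_EFinP; apply: measurable_funM => //; apply: measurable_funX.
      apply: measurable_funD => //; apply: measurable_funM => //.
      apply: continuous_measurable_fun => x; apply: cvgV; first by rewrite gt_eqF.
      exact: abs_cont_continuous.
    transitivity (fisher phi - 1)%E; last by rewrite fJ1 subee.
    rewrite -score_deficit; apply: eq_integral => x _; rewrite gee0_abs // lee_fin.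
    by rewrite mulr_ge0 ?sqr_ge0 // ltW.
  apply: filterS => x /(_ Logic.I) /= [] /eqP.
  rewrite mulf_eq0 [X in _ || X]gt_eqF // orbF sqrf_eq0 => /eqP h.
  have px : phi x != 0 by rewrite gt_eqF.
  by rewrite -[LHS](divfK px) (_ : dphi x / phi x = - x) //; lra.
pose u (x : R) := expR (x ^+ 2 / 2).
have du (x : R) : is_derive x (1 : R) u (x * u x).
  have D : is_derive x (1 : R) (fun x : R => x ^+ 2 / 2) x.
    by apply: is_derive_eq; rewrite /GRing.scale /=; field.
  have H := @is_derive1_comp _ expR (fun x : R => x ^+ 2 / 2) x _ _
    (is_derive_expR (x ^+ 2 / 2)) D.
  by apply: (is_derive_eq H); rewrite mulrC.
have cdu : continuous (fun x : R => x * u x).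
  by move=> x; apply: cvgM; [exact: cvg_id|exact: (is_derive_continuous du)].
have ac : abs_cont (phi \* u) by apply: abs_contM => //; exact: c1_abs_cont du cdu.
have cst_itv (a b : R) : a < b -> phi b * u b = phi a * u a.
  move=> ab; have [_ _] := abs_cont_itv_ftc ab ac.
  rewrite (_ : (\int[mu]_(x in _) _)%E = 0%E); last first.
    rewrite -(integral0 mu `[a, b]%classic); apply: ae_eq_integral => //.
      apply/measurable_EFinP/measurable_funTS.
      by apply: measurable_derive1; exact: abs_cont_continuous.
    apply: filterS2 dphiE (abs_cont_derivable acphi) => x dE dx _ /=.
    by rewrite (derive1_mul dx (du x)) -/dphi dE; congr EFin; ring.
  by move=> [] /esym/eqP; rewrite subr_eq0 => /eqP.
have phiE x : phi x = phi 0 * expR (- (x ^+ 2 / 2)).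
  have E : phi x * u x = phi 0.
    have -> : phi 0 = phi 0 * u 0 by rewrite /u expr0n mul0r expR0 mulr1.
    by have [|/cst_itv|->] := ltgtP x 0; [move=> /cst_itv|..].
  by rewrite -E /u -mulrA -expRD addrN expR0 mulr1.
have p1 : normal_peak (1 : R) != 0 by rewrite gt_eqF // normal_peak_gt0 // oner_eq0.
have phiN x : phi x = phi 0 / normal_peak 1 * normal_pdf 0 1 x.
  rewrite phiE normal_pdf_neq0E ?oner_eq0 // subr0 expr1n mulrA divfK //.
  by rewrite mulNr.
exists 0, 1; split => //; apply/funext => x; rewrite phiN.
(* [phi] is a multiple of the standard normal density, and comparing masses makes the factor 1. *)
suff -> : phi 0 / normal_peak 1 = 1 by rewrite mul1r.
have := sp_mass hphi; under eq_integral do rewrite phiN.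
rewrite integralZ_fun; last exact: (integrable_normal_pdf 0 1).
by rewrite integral_normal_pdf mule1 => -[].
Qed.

(** The standardisation has to force [m = 0] and [s^2 = 1]. From [phi' = - (x - m) / s^2 phi], the
    integral of [phi'] is both 0 and [m / s^2], and integrating [x phi'] by parts then gives
    [1 / s^2 = 1]. *)
Lemma fisher_gaussian : is_gaussian phi -> fisher phi = 1%E.
Proof.
move=> [m [s [s0 phiE]]]; have sn0 : s != 0 by rewrite gt_eqF.
have dE x : dphi x = - ((x - m) / s ^+ 2) * phi x.
  by rewrite /dphi derive1E phiE; have [_ ->] := is_derive_normal_pdf m x sn0.
have ip := profile_integrable hphi.
have ix := profile_integrable1 hphi.
have ix2 := profile_integrable2 hphi.
have m0 : m = 0.
  have E : (\int[mu]_x (dphi x)%:E = (m / s ^+ 2)%:E)%E.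
    transitivity (\int[mu]_x (- (s ^- 2) * (x * phi x) + m / s ^+ 2 * phi x)%:E)%E.
      by apply: eq_integral => x _; rewrite dE; congr EFin; ring.
    rewrite integralD_fun ?integralZ_fun //; [|exact: integrableZ_fun..].
    by rewrite (sp_mean hphi) (sp_mass hphi) mule0 mule1 add0e.
  have : mu.-integrable setT (EFin \o dphi).
    rewrite (_ : dphi = fun x => - (s ^- 2) * (x * phi x) + m / s ^+ 2 * phi x).
      by apply: integrableD_fun; exact: integrableZ_fun.
    by apply/funext => x; rewrite dE; ring.
  move=> /(integral_derive1 (sp_abs_cont hphi) ip); rewrite E => -[] /eqP.
  by rewrite mulf_eq0 invr_eq0 expf_eq0 (negbTE sn0) andbF orbF => /eqP.
have s1 : s ^+ 2 = 1.
  have := integral_id_derive1 (sp_abs_cont hphi) ip ixdphi.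
  rewrite (_ : (\int[mu]_x _)%E =
    \int[mu]_x (- (s ^- 2) * (x ^+ 2 * phi x) + 1 * phi x)%:E)%E; last first.
    by apply: eq_integral => x _; rewrite -/dphi dE m0 subr0; congr EFin; ring.
  rewrite integralD_fun ?integralZ_fun //; [|exact: integrableZ_fun..].
  rewrite (sp_var hphi) (sp_mass hphi) !mule1 -EFinD => -[] /eqP.
  by rewrite addrC subr_eq0 => /eqP e; rewrite -[LHS]invrK -e invr1.
transitivity (\int[mu]_x ((0 + - 1 * x) ^+ 2 * phi x)%:E)%E.
  apply: eq_integral => x _; rewrite -/dphi dE m0 s1; congr EFin.
  by field; rewrite gt_eqF.
by rewrite (profile_quad_moment hphi) expr0n add0r sqrrN expr1n.
Qed.

End profile.

(** Half of the exponent absorbs the square: [x^2 / 4 <= exp (x^2 / 4)], so the integrand is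
    dominated by a multiple of the normal density of variance 2. *)
Lemma integrable_sqr_normal_pdf :
  mu.-integrable setT (EFin \o (fun x : R => x ^+ 2 * normal_pdf 0 1 x)).
Proof.
have o0 : (1 : R) != 0 by rewrite oner_eq0.
have r2 : Num.sqrt (2 : R) != 0 by rewrite gt_eqF // sqrtr_gt0.
have i2 := integrable_normal_pdf (0 : R) (Num.sqrt 2).
have p2 : 0 < normal_peak (Num.sqrt (2 : R)) by exact: normal_peak_gt0.
apply: (@le_integrable_fun _ _ (fun x => 4 * normal_peak 1 / normal_peak (Num.sqrt 2) *
    normal_pdf 0 (Num.sqrt 2) x)).
- by apply: measurable_funM; [exact: measurable_funX|exact: measurable_normal_pdf].
- move=> x; rewrite ger0_norm; last by rewrite mulr_ge0 ?sqr_ge0 ?normal_pdf_ge0.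
  rewrite !normal_pdf_neq0E // subr0 expr1n sqr_sqrtr //.
  rewrite mulrA divfK ?gt_eqF // mulrCA [leRHS]mulrAC [leRHS]mulrC ler_wpM2l ?normal_peak_ge0 //.
  have -> : - x ^+ 2 / (1 *+ 2) = - (x ^+ 2 / 4) - (x ^+ 2 / 4) by field.
  have -> : - x ^+ 2 / (2 *+ 2) = - (x ^+ 2 / 4) by field.
  rewrite expRD mulrA ler_wpM2r ?expR_ge0 // expRN ler_pdivrMr ?expR_gt0 //.
  by have := expR_ge1Dx (x ^+ 2 / 4); lra.
- exact: integrableZ_fun.
Qed.

(** Everything comes from [phi' = - x phi]: the integral of [phi'] gives the mean, integrating
    [x phi'] by parts gives the variance, and the Fisher integrand is [x^2 phi]. *)
Lemma standard_profile_normal : standard_profile (@normal_pdf R 0 1).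
Proof.
have o0 : (1 : R) != 0 by rewrite oner_eq0.
pose phi := @normal_pdf R 0 1.
have D (x : R) : is_derive x (1 : R) phi (- x * phi x).
  by apply: (is_derive_eq (is_derive_normal_pdf 0 x o0)); rewrite subr0 expr1n divr1.
have dE x : derive1 phi x = - x * phi x by rewrite derive1E; have [_ ->] := D x.
have cphi : continuous phi by exact: is_derive_continuous D.
have acphi : abs_cont phi.
  apply: c1_abs_cont D _ => x; apply: cvgM; last exact: cphi.
  by apply: cvgN; exact: cvg_id.
have p0 x : 0 < phi x by rewrite /phi normal_pdf_neq0E // mulr_gt0 ?expR_gt0 ?normal_peak_gt0.
have ip : mu.-integrable setT (EFin \o phi) by exact: integrable_normal_pdf.
have ix2 : mu.-integrable setT (EFin \o (fun x => x ^+ 2 * phi x)).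
  exact: integrable_sqr_normal_pdf.
have mphi : measurable_fun setT phi by exact: measurable_normal_pdf.
have ix : mu.-integrable setT (EFin \o (fun x => x * phi x)).
  apply: (@le_integrable_fun _ _ (fun x => phi x + x ^+ 2 * phi x)).
  - exact: measurable_funM.
  - move=> x; rewrite normrM (gtr0_norm (p0 x)) -[X in X + _]mul1r -mulrDl.
    rewrite ler_wpM2r ?(ltW (p0 x)) // -(real_normK (num_real x)).
    have := sqr_ge0 (`|x| - 1); have := normr_ge0 x; nra.
  - exact: integrableD_fun.
have var1 : (\int[mu]_x (x ^+ 2 * phi x)%:E = 1)%E.
  have ixd : mu.-integrable setT (EFin \o (fun x => x * derive1 phi x)).
    rewrite (_ : (fun x => _) = fun x => - 1 * (x ^+ 2 * phi x)); first exact: integrableZ_fun.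
    by apply/funext => x; rewrite dE; ring.
  have := integral_id_derive1 acphi ip ixd.
  rewrite (_ : (\int[mu]_x _)%E = \int[mu]_x (- 1 * (x ^+ 2 * phi x) + phi x)%:E)%E; last first.
    by apply: eq_integral => x _; rewrite dE; congr EFin; ring.
  rewrite integralD_fun ?integralZ_fun //; last exact: integrableZ_fun.
  rewrite integral_normal_pdf; have := integrable_fin_num measurableT ix2.
  rewrite /comp => /fineK <-; rewrite -EFinM -EFinD => -[] e; congr EFin; lra.
split => //.
- by rewrite integral_normal_pdf.
- have idp : mu.-integrable setT (EFin \o derive1 phi).
    rewrite (_ : derive1 phi = fun x => - 1 * (x * phi x)); first exact: integrableZ_fun.
    by apply/funext => x; rewrite dE; ring.
  have := integral_derive1 acphi ip idp.
  rewrite (_ : (\int[mu]_x _)%E = \int[mu]_x (- 1 * (x * phi x))%:E)%E; last first.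
    by apply: eq_integral => x _; rewrite dE; congr EFin; ring.
  rewrite integralZ_fun //; have := integrable_fin_num measurableT ix.
  rewrite /comp => /fineK <-; rewrite -EFinM => -[] e; congr EFin; lra.
- rewrite /fisher (_ : (\int[mu]_x _)%E = \int[mu]_x (x ^+ 2 * phi x)%:E)%E.
    by rewrite var1 ltry.
  apply: eq_integral => x _; rewrite -/phi dE; congr EFin.
  by field; rewrite gt_eqF // p0.
Qed.

Lemma fisher_locscale (phi : R -> R) (x : 'rV[R]_2) : standard_profile phi ->
  half_plane x -> fisher (locscale phi x) = (fine (fisher phi) / x 0 1 ^+ 2)%:E.
Proof.
move=> hphi hx; have s0 : 0 < x 0 1 := hx.
have acphi := sp_abs_cont hphi; have phi_gt0 := sp_gt0 hphi.
have cphi := abs_cont_continuous acphi.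
have cp : continuous (locscale phi x).
  move=> z; apply: cvgM; first exact: cvg_cst.
  apply: (@cvg_comp _ _ _ (fun z => (z - x 0 0) / x 0 1) phi); last exact: cphi.
  by apply: cvgM; [apply: cvgB; [exact: cvg_id|exact: cvg_cst]|exact: cvg_cst].
have p0 z : 0 < locscale phi x z by rewrite mulr_gt0 ?invr_gt0.
have mF : measurable_fun setT
    (fun z => (derive1 (locscale phi x) z ^+ 2 / locscale phi x z)%:E).
  apply/measurable_EFinP; apply: measurable_funM.
    by apply: measurable_funX; exact: measurable_derive1.
  by apply: continuous_measurable_fun => z; apply: cvgV; [rewrite gt_eqF|exact: cp].
have mG : measurable_fun setT (fun z => (derive1 phi z ^+ 2 / phi z)%:E).
  apply/measurable_EFinP; apply: measurable_funM.
    by apply: measurable_funX; exact: measurable_derive1.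
  by apply: continuous_measurable_fun => z; apply: cvgV; [rewrite gt_eqF|exact: cphi].
rewrite /fisher (@ge0_integral_affine _ (x 0 0) (x 0 1)) //; last first.
  by move=> z; rewrite lee_fin divr_ge0 ?sqr_ge0 // ltW.
(* With [s = x 0 1], the squared derivative carries [s^-4] and division by the density returns one
   [s]; the Jacobian supplies another, for [s^-2] in all. The chain rule applies only where [phi] is
   derivable, hence almost everywhere. *)
rewrite (_ : (\int[mu]_y _)%E =
    \int[mu]_y ((x 0 1 ^- 3)%:E * (derive1 phi y ^+ 2 / phi y)%:E))%E; last first.
  apply: ae_eq_integral => //.
  - apply: (measurableT_comp mF).
    by apply: measurable_funD => //; apply: measurable_funM.
  - exact: emeasurable_funM.
  - have aef : Filter (nbhs (almost_everywhere mu)) := ae_filter_ringOfSetsType mu.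
    apply: filterS (abs_cont_derivable acphi) => y dy _.
    pose u (z : R) := (z - x 0 0) / x 0 1.
    have uy : u (x 0 0 + x 0 1 * y) = y by rewrite /u; field; rewrite gt_eqF.
    have Du : is_derive (x 0 0 + x 0 1 * y) (1 : R) u (x 0 1)^-1.
      by rewrite /u; apply: is_derive_eq; rewrite /GRing.scale /=; ring.
    have Dphi : is_derive (u (x 0 0 + x 0 1 * y)) (1 : R) phi (derive1 phi y).
      by rewrite uy; apply: DeriveDef => //; rewrite derive1E.
    have D1 := @is_derive1_comp _ phi u (x 0 0 + x 0 1 * y) _ _ Dphi Du.
    have D2 := is_deriveM (is_derive_cst (x 0 1)^-1 (x 0 0 + x 0 1 * y) 1) D1.
    have [_ E] := D2.
    rewrite derive1E [X in X ^+ 2 / _](_ : _ = x 0 1 ^- 2 * derive1 phi y); last first.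
      by rewrite [LHS]E /GRing.scale /cst /=; field; rewrite gt_eqF.
    rewrite /locscale -/(u _) uy -EFinM; congr EFin; field.
    by rewrite !gt_eqF.
rewrite ge0_integralZl //; last 2 first.
- by move=> y _; rewrite lee_fin divr_ge0 ?sqr_ge0 // ltW.
- by rewrite lee_fin invr_ge0 exprn_ge0 // ltW.
rewrite -/(fisher phi) -(fineK (fisher_fin_num hphi)) -!EFinM; congr EFin.
by rewrite fineK ?fisher_fin_num //; field; rewrite gt_eqF.
Qed.

Lemma gauss_curvature_cost (phi : R -> R) (x : 'rV[R]_2) : standard_profile phi ->
  half_plane x ->
  gauss_curvature (cost_metric0 (@relief_2J R) (locscale phi)) x
   = - (1 / (4 * fine (fisher phi))).
Proof.
move=> hphi hx; apply: gauss_curvature_hyperbolic => // [|y hy].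
  by rewrite mulr_gt0 // (lt_le_trans ltr01) // fisher_ge1.
rewrite /cost_metric0 transport_metric_locscale // /relief_2J fisher_locscale //=.
rewrite scalemx1; congr (_%:M); ring.
Qed.

End fisher_information.

Theorem theorem4p19 (R : realType) (phi0 : R -> R)
    (hphi0 : standard_profile phi0) :
  let J0 : R := fine (fisher phi0) in
  let K : R := - (1 / (4 * J0)) in
  let p := locscale phi0 in
  (* (i) *)
  [/\ set_bij (@half_plane R) (locscale_family phi0) p,
      forall x y, half_plane x -> half_plane y ->
        W2 (law (p x)) (law (p y)) = (euclid_dist x y)%:E,
      forall x, half_plane x -> transport_metric p x = 1%:M,
      forall x, half_plane x -> fisher (p x) = (J0 / (x 0 1) ^+ 2)%:E &
      forall x, half_plane x -> relief_2J (p x) = (2 * J0 / (x 0 1) ^+ 2)%:E]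
  /\
  (* (ii) *)
  ((forall x, half_plane x ->
      gauss_curvature (cost_metric0 (@relief_2J R) p) x = K)
   /\ K < 0)
  /\
  (* (iii) *)
  [/\ 1 <= J0,
      J0 = 1 <-> is_gaussian phi0,
      - (1 / 4) <= K /\ K < 0,
      standard_profile (@normal_pdf R 0 1) &
      forall x : 'rV[R]_2, half_plane x ->
        gauss_curvature
          (cost_metric0 (@relief_2J R) (locscale (@normal_pdf R 0 1))) x
        = - (1 / 4)].
Proof.
move=> J0 K p.
have J1 : 1 <= J0 := fisher_ge1 hphi0.
have J_gt0 : 0 < J0 := lt_le_trans ltr01 J1.
have K0 : K < 0 by rewrite oppr_lt0 divr_gt0 // mulr_gt0.
have fp x : half_plane x -> fisher (p x) = (J0 / (x 0 1) ^+ 2)%:E.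
  by move=> hx; exact: fisher_locscale.
split; [split|split].
- exact: locscale_bij.
- by move=> x y hx hy; exact: W2_locscale.
- by move=> x hx; exact: transport_metric_locscale.
- exact: fp.
- by move=> x hx; rewrite /relief_2J fp // -EFinM mulrA.
- by split => // x hx; exact: gauss_curvature_cost.
split => //.
- by split => [|/(fisher_gaussian hphi0) E]; [exact: fisher_eq1_gaussian|rewrite /J0 E].
- split => //; rewrite /K lerN2 ler_pdivrMr ?mulr_gt0 // mulrA divfK //.
  by rewrite mul1r.
- exact: standard_profile_normal.
- move=> x hx; rewrite gauss_curvature_cost //; last exact: standard_profile_normal.
  rewrite (fisher_gaussian standard_profile_normal) ?mulr1 //.
  by exists 0, 1.
Qed.
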